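(* Let $(A,p)$ be a Cartan super-datum, $P\in M_n(\Bbbk)$ a matrix of Cartan type with associated Cartan matrix $A$, $\mathcal{R}=(\mathfrak{h},\Pi,\Pi^\vee)$ a realization of $P$ over $\Bbbk$, and $\mathfrak{g}^{\mathcal{R},p}_P$ the associated MpLSbA. Let $\chi\in\mathrm{Alt}^S_{\Bbbk}(\mathfrak{h})$ and let $\chi_{\mathfrak g}$ be the associated toral 2-cocycle. (a) There exists a Lie superbialgebra isomorphism $\mathfrak{g}_{P_{(\chi)}}^{\mathcal{R}_{(\chi)},p}\cong\big(\mathfrak{g}^{\mathcal{R},p}_P\big)_{\chi_{\mathfrak g}}$. (b) Let $P,P'\in M_n(\Bbbk)$ be two matrices of Cartan type with the same associated Cartan matrix $A$. Then the following holds: (b.1) Let $\mathcal{R}$ be a split realization of $P$ and let $\mathfrak{g}_P^{\mathcal{R},p}$ be the associated MpLSbA. Then there is $\chi\in\mathrm{Alt}^S_{\Bbbk}(\mathfrak{h})$ such that $P'=P_{(\chi)}$, the corresponding $\mathcal{R}_{(\chi)}$ is a split realization of $P'$, and for the 2-cocycle $\chi_{\mathfrak g}$ one has $\mathfrak{g}_{P'}^{\mathcal{R}_{(\chi)},p}\cong\big(\mathfrak{g}_P^{\mathcal{R},p}\big)_{\chi_{\mathfrak g}}$. (b.2) Let $\mathcal{R}$ and $\mathcal{R}'$ be split minimal realizations of $P$ and $P'$ respectively, and let $\mathfrak{g}_P^{\mathcal{R},p}$ and $\mathfrak{g}_{P'}^{\mathcal{R}',p}$ be the associated MpLSbA's.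 Then there exists $\chi\in\mathrm{Alt}^S_{\Bbbk}(\mathfrak{h})$ such that for the 2-cocycle $\chi_{\mathfrak g}$ one has $\mathfrak{g}_{P'}^{\mathcal{R}',p}\cong\big(\mathfrak{g}_P^{\mathcal{R},p}\big)_{\chi_{\mathfrak g}}$. (b.3) Every split minimal MpLSbA is isomorphic to some toral 2-cocycle deformation of Yamane's Lie superbialgebra.
   Context: $\Bbbk$ is a field of characteristic zero, $I=\{1,\dots,n\}$. Cartan super-data. A Cartan super-datum $(A,p)$ is read off one of the following labelled Dynkin diagrams (vertices are white $\circ$, black $\bullet$ or grey $\otimes$; $\times$ means white or grey; vertices are numbered $1,\dots,n$ from left to right unless indicated): $A_n$: $\times-\times-\cdots-\times$; $B_n(I)$: $\times-\cdots-\times\Rightarrow\circ$; $B_n(II)$: $\times-\cdots-\times\Rightarrow\bullet$; $C_n$: $\times-\cdots-\times\Leftarrow\circ$; $D_n(I)$: a chain of $\times$-vertices $1,\dots,n-2$ with $n-2$ joined to two white vertices $n-1$, $n$; $D_n(II)$: the same with $n-1,n$ grey and joined to each other by a double edge; $F_4$: $\circ_1-\circ_4\Rightarrow\circ_3-\otimes_2$; $G_3$: $\otimes_1-\circ_3\Leftarrow\circ_2$ (triple edge, arrow towards vertex $3$). The parity $p:I\to\mathbb{Z}_2=\{\bar0,\bar1\}$ is $\bar0$ on white and $\bar1$ on black or grey vertices; $A=(a_{ij})\in M_n(\mathbb{Z})$ is the (symmetrizable) Cartan matrix attached to the diagram as follows. In types $A_n,B_n,C_n,D_n$ let $e_1,e_2,\dots$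 be orthogonal vectors with $(e_i,e_i)=\varepsilon_i\in\{1,-1\}$, and put $\beta_i=e_i-e_{i+1}$ for $i\le n-1$ and $\beta_n=e_n-e_{n+1}$, $e_n$, $2e_n$, $e_{n-1}+e_n$ in type $A_n$, $B_n$, $C_n$, $D_n$ respectively, where $\varepsilon_{i+1}=\varepsilon_i$ if vertex $i$ is white and $\varepsilon_{i+1}=-\varepsilon_i$ if it is grey, for all $i$ with $\beta_i=e_i-e_{i+1}$; then $a_{ij}=2(\beta_i,\beta_j)/(\beta_i,\beta_i)$ if vertex $i$ is white or black, and $a_{ij}=\varepsilon_i(\beta_i,\beta_j)$ if it is grey (with $\varepsilon_{n-1}$ in place of $\varepsilon_i$ for $i=n$ in type $D_n(II)$). In type $F_4$ the nonzero entries are $a_{11}=a_{33}=a_{44}=2$, $a_{14}=a_{41}=a_{43}=a_{32}=-1$, $a_{34}=-2$, $a_{23}=1$; in type $G_3$ they are $a_{22}=a_{33}=2$, $a_{13}=1$, $a_{31}=a_{23}=-1$, $a_{32}=-3$. Fix minimal $d_i\in\frac12\mathbb{Z}\setminus\{0\}$ such that $DA$ is symmetric with integral entries, $D=\mathrm{diag}(d_i)$ (in types $A$–$D$, with overall sign such that $DA$ is a positive multiple of $((\beta_i,\beta_j))_{i,j}$). Realizations. $P=(p_{ij})\in M_n(\Bbbk)$ is of Cartan type, with associated Cartan matrix $A$, if $\frac12(P+P^T)=DA$. A realization of $P$ over $\Bbbk$ is $\mathcal{R}=(\mathfrak{h},\Pi,\Pi^\vee)$ with $\mathfrak{h}$ a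 finite-dimensional $\Bbbk$-vector space, $\Pi^\vee=\{T_i^+,T_i^-\}_{i\in I}\subseteq\mathfrak{h}$, $\Pi=\{\alpha_i\}_{i\in I}\subseteq\mathfrak{h}^*$, such that $\alpha_j(T_i^+)=p_{ij}$, $\alpha_j(T_i^-)=p_{ji}$, and the $S_i:=\frac12(T_i^++T_i^-)$ are linearly independent. It is straight if the $\alpha_i$ are linearly independent in $\mathfrak h^*$, split if the $2n$ elements $T_i^\pm$ are linearly independent, and minimal if the $T_i^\pm$ span $\mathfrak h$. The Lie superalgebra $\mathfrak{g}^{\mathcal{R},p}_P$ is generated over $\Bbbk$ by the vector space $\mathfrak{h}$ (even) and elements $E_i,F_i$ ($i\in I$) of parity $p(i)$, with relations (for $T,T'\in\mathfrak h$, $i,j,\ell\in I$): $[T,T']=0$; $[T,E_j]=\alpha_j(T)E_j$; $[T,F_j]=-\alpha_j(T)F_j$; $[E_i,F_\ell]=\delta_{i\ell}\frac{T_i^++T_i^-}{2d_i}$; $[E_i,E_j]=0=[F_i,F_j]$ if $a_{ij}=0$; $(\mathrm{ad}\,E_i)^{1-a_{ij}}(E_j)=0=(\mathrm{ad}\,F_i)^{1-a_{ij}}(F_j)$ if $i\neq j$, $p(i)=\bar0$; and, for $X\in\{E,F\}$: (1) $[[[X_i,X_j],X_k],X_j]=0$ whenever $i,j,k$ form a subdiagram $\times_i-\otimes_j-\times_k$, or $\times_i-\otimes_j\Rightarrow\bullet_k$, or $\times_i-\otimes_j\Rightarrow\times_k$; (2) $[[[X_{n-1},X_n],X_n],X_n]=0$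 in type $B_n$ with $\times_{n-1}\Rightarrow\bullet_n$; (3) $[[X_{n-2},X_{n-1}],X_n]-[[X_{n-2},X_n],X_{n-1}]=0$ in type $D_n(II)$; (4) $[[[[X_{n-2},X_{n-1}],X_n],[X_{n-2},X_{n-1}]],X_{n-1}]=0$ in type $C_n$ with $\otimes_{n-2}-\otimes_{n-1}\Leftarrow\circ_n$; (5) $[[[[[[X_{n-3},X_{n-2}],X_{n-1}],X_n],X_{n-1}],X_{n-2}],X_{n-1}]=0$ in type $C_n$ with $\times_{n-3}-\otimes_{n-2}-\otimes_{n-1}\Leftarrow\circ_n$. With $x\wedge y:=\frac12(x\otimes y-(-1)^{|x||y|}y\otimes x)$, it is a Lie superbialgebra, called a multiparameter Lie superbialgebra (MpLSbA), with Lie cobracket $\delta(T)=0$, $\delta(E_i)=2T_i^+\wedge E_i$, $\delta(F_i)=2T_i^-\wedge F_i$. It is called split (minimal) if $\mathcal R$ is. Yamane's Lie superbialgebra is the MpLSbA $\mathfrak g^{\mathcal R,p}_{P_A}$ attached to the symmetric matrix $P_A:=DA$ and to a realization $\mathcal R$ of $P_A$ which is split, straight and minimal. 2-cocycle deformations. $\mathrm{Alt}^S_{\Bbbk}(\mathfrak h)$ is the set of antisymmetric bilinear maps $\chi:\mathfrak h\times\mathfrak h\to\Bbbk$ with $\chi(S_i,-)=0=\chi(-,S_i)$ for all $i\in I$. For such $\chi$ put $P_{(\chi)}:=\big(p_{ij}+\chi(T_i^+,T_j^+)\big)_{i,j}$, $\alpha_i^{(\chi)}:=\alpha_i\pm\chi(-,T_i^\pm)$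 (independent of the sign), $\mathcal R_{(\chi)}:=(\mathfrak h,\{\alpha_i^{(\chi)}\}_{i\in I},\Pi^\vee)$, which is a realization of $P_{(\chi)}$. Let $\mathfrak n_+$, $\mathfrak n_-$ be the subsuperalgebras of $\mathfrak g:=\mathfrak g^{\mathcal R,p}_P$ generated by the $E_i$'s, resp. the $F_i$'s; then $\mathfrak g=\mathfrak n_+\oplus\mathfrak h\oplus\mathfrak n_-$; let $\pi:\mathfrak g\to\mathfrak h$ be the corresponding projection. The toral 2-cocycle associated with $\chi$ is $\chi_{\mathfrak g}:=\chi\circ(\pi\otimes\pi)$. The (toral) 2-cocycle deformation $\mathfrak g_{\chi_{\mathfrak g}}$ has the same cobracket as $\mathfrak g$ and the new superbracket $[x,y]_{\chi_{\mathfrak g}}:=[x,y]-x_{[1]}\chi_{\mathfrak g}(x_{[2]},y)-(-1)^{|x||y_{[1]}|}y_{[1]}\chi_{\mathfrak g}(x,y_{[2]})$, where $\delta(x)=x_{[1]}\otimes x_{[2]}$ (summation understood) as element of $\mathfrak g\otimes\mathfrak g$. *)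

(* Defs.v *)
From HB Require Import structures.
From mathcomp Require Import all_boot all_order all_algebra.
From mathcomp Require Import boolp.
From mathcomp Require Import freeg.

Set Implicit Arguments.
Unset Strict Implicit.
Unset Printing Implicit Defensive.

Import Order.TTheory GRing.Theory Num.Theory.

Local Open Scope ring_scope.
Local Open Scope quotient_scope.

Section Span.
Context (k : fieldType) (V : lmodType k).

Inductive lspan (S : V -> Prop) : V -> Prop :=
| lspan_gen x of S x : lspan S x
| lspan_zero : lspan S 0
| lspan_add x y of lspan S x & lspan S y : lspan S (x + y)
| lspan_scale a x of lspan S x : lspan S (a *: x).

Definition in_lspan (S : V -> Prop) (x : V) : bool := `[< lspan S x >].

Lemma in_lspanP S x : reflect (lspan S x) (x \in in_lspan S).
Proof. by apply: (iffP idP) => [/asboolP|H]; last apply/asboolP. Qed.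

Lemma in_lspan_zmod_closed S : zmod_closed (in_lspan S).
Proof.
split; first by apply/in_lspanP; exact: lspan_zero.
move=> x y /in_lspanP Hx /in_lspanP Hy; apply/in_lspanP.
by apply: lspan_add => //; rewrite -scaleN1r; apply: lspan_scale.
Qed.

HB.instance Definition _ S :=
  GRing.isZmodClosed.Build V (in_lspan S) (in_lspan_zmod_closed S).

Definition quot (S : V -> Prop) : Type := Quotient.quot (GRing.ZmodClosed.clone V (in_lspan S) _).

HB.instance Definition _ S := GRing.Zmodule.on (quot S).
HB.instance Definition _ S := Quotient.on (quot S).

Context (S : V -> Prop).

Definition qpi (x : V) : quot S := \pi_(quot S) x.

Lemma qpi_eqP x y : qpi x = qpi y <-> lspan S (x - y).
Proof.
have E : (x - y \in in_lspan S) = (qpi x == qpi y) by exact: Quotient.idealrBE.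
split=> [/eqP|/in_lspanP]; first by rewrite -E => /in_lspanP.
by rewrite E => /eqP.
Qed.

Lemma qpi_repr x : qpi (repr x) = x.
Proof. exact: reprK. Qed.

Lemma qpiD x y : qpi (x + y) = qpi x + qpi y.
Proof. exact: (@Quotient.pi_add V (GRing.ZmodClosed.clone V (in_lspan S) _)). Qed.

Definition qscale (a : k) (x : quot S) : quot S := qpi (a *: repr x).

Lemma qscaleE a x : qscale a (qpi x) = qpi (a *: x).
Proof.
apply/qpi_eqP; rewrite -scalerBr; apply: lspan_scale.
by apply/qpi_eqP; rewrite qpi_repr.
Qed.

Lemma qscaleA a b x : qscale a (qscale b x) = qscale (a * b) x.
Proof. by rewrite -(qpi_repr x) !qscaleE scalerA. Qed.
Lemma qscale1 : left_id 1 qscale.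
Proof. by move=> x; rewrite -(qpi_repr x) !qscaleE scale1r. Qed.
Lemma qscaleDr : right_distributive qscale +%R.
Proof.
move=> a x y; rewrite -(qpi_repr x) -(qpi_repr y).
by rewrite -qpiD !qscaleE scalerDr qpiD.
Qed.
Lemma qscaleDl x : {morph qscale^~ x : a b / a + b}.
Proof. by move=> a b; rewrite -(qpi_repr x) !qscaleE scalerDl qpiD. Qed.

HB.instance Definition _ :=
  GRing.Zmodule_isLmodule.Build k (quot S) qscaleA qscale1 qscaleDr qscaleDl.

End Span.

Section FreeLift.
Context (k : fieldType) (K : choiceType) (M : lmodType k) (f : K -> M).

Lemma fglift_is_linear : linear (fglift f : {freeg K / k} -> M).
Proof.
have fB : additive (fglift f : {freeg K / k} -> M) by exact: lift_is_additive.
have f0 : fglift f (0 : {freeg K / k}) = 0 by rewrite -(subrr 0) fB subrr.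
have fD x y : fglift f (x + y : {freeg K / k}) = fglift f x + fglift f y.
  by rewrite -{1}(opprK y) fB -(sub0r y) fB f0 sub0r opprK.
move=> a x y; rewrite fD; congr (_ + _).
rewrite -(freeg_sumE x); elim: (dom x) => [|m r IH].
  by rewrite big_nil scaler0 f0 scaler0.
have fgscaleU b c : b *: (<< c *g m >> : {freeg K / k}) = << b * c *g m >>.
  by apply/eqP/freeg_eqP => z; rewrite coeffZ !coeffU mulrA.
by rewrite big_cons scalerDr !fD IH scalerDr fgscaleU !liftU scalerA.
Qed.

HB.instance Definition _ :=
  GRing.isLinear.Build k {freeg K / k} M *:%R (fglift f) fglift_is_linear.

End FreeLift.

(* The map induced on [quot S] by [f]; meaningful when [f] is linear and
   vanishes on [S]. *)
Definition qlift (k : fieldType) (V : lmodType k) (S : V -> Prop) (W : Type)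
  (f : V -> W) (x : quot S) : W := f (repr x).

Lemma qliftE (k : fieldType) (V W : lmodType k) (S : V -> Prop)
    (f : {linear V -> W}) (x : V) :
  (forall y, S y -> f y = 0) -> qlift f (qpi S x) = f x.
Proof.
move=> fS; apply/eqP; rewrite -subr_eq0 -linearB; apply/eqP.
have : lspan S (repr (qpi S x) - x) by apply/qpi_eqP; rewrite qpi_repr.
elim=> [y /fS //||y z _ yE _ zE|a y _ yE].
- by rewrite linear0.
- by rewrite linearD yE zE addr0.
- by rewrite linearZ_LR yE scaler0.
Qed.

Section Tensor.
Context (k : fieldType) (V W : lmodType k).

Inductive bilinear_rel : {freeg (V * W)%type / k} -> Prop :=
| bilinear_rel_l a v v' w :
    bilinear_rel (<< (a *: v + v', w) >> - (a *: << (v, w) >> + << (v', w) >>))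
| bilinear_rel_r a v w w' :
    bilinear_rel (<< (v, a *: w + w') >> - (a *: << (v, w) >> + << (v, w') >>)).

Definition tens := quot bilinear_rel.
HB.instance Definition _ := GRing.Lmodule.on tens.

Definition tensor (v : V) (w : W) : tens := qpi bilinear_rel << (v, w) >>.

(* The linear map with [tensor v w |-> B v w], for bilinear [B]. *)
Definition tlift (U : lmodType k) (B : V -> W -> U) : tens -> U :=
  qlift (fglift (fun vw => B vw.1 vw.2)).

Lemma tliftE (U : lmodType k) (B : {bilinear V -> W -> U}) (v : V) (w : W) :
  tlift B (tensor v w) = B v w.
Proof.
rewrite /tlift /tensor qliftE => [|_ [a v1 v2 w1|a v1 w1 w2]].
- by rewrite /= liftU scale1r.
- by rewrite linearB linearD linearZ /= !liftU !scale1r /= linearPl subrr.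
- by rewrite linearB linearD linearZ /= !liftU !scale1r /= linearPr subrr.
Qed.

End Tensor.

(* A superspace is a module [V] with [pr a] the projection onto its component
   of parity [a] ([false] is even). Formulas with signs such as
   [(-1)^{|x||y|}] are extended to all elements through these projections. *)
Section Super.
Context (k : fieldType) (V : lmodType k) (pr : bool -> V -> V).

Definition hom (a : bool) (x : V) : Prop := pr a x = x.

Definition is_superspace : Prop :=
  [/\ forall a, linear (pr a),
      forall a b x, pr a (pr b x) = if a == b then pr a x else 0
    & forall x, pr false x + pr true x = x].

(* u (x) v |-> (-1)^{|u||v|} v (x) u *)
Definition sflip : tens V V -> tens V V :=
  tlift (fun u v => \sum_(a : bool) \sum_(b : bool)
                      (-1) ^+ (a && b) *: tensor (pr b v) (pr a u)).

Definition wedge (x y : V) : tens V V :=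
  2^-1 *: (tensor x y - sflip (tensor x y)).

Definition tpr (a : bool) : tens V V -> tens V V :=
  tlift (fun u v => \sum_(b : bool) tensor (pr b u) (pr (a (+) b) v)).

(* u (x) v (x) w |-> (-1)^{|u|(|v|+|w|)} v (x) w (x) u *)
Definition scycle : tens V (tens V V) -> tens V (tens V V) :=
  tlift (fun u vw => tlift (fun v w =>
    \sum_(a : bool) \sum_(b : bool) \sum_(c : bool)
      (-1) ^+ (a && (b (+) c)) *:
        tensor (pr b v) (tensor (pr c w) (pr a u))) vw).

Variable br : V -> V -> V.

Definition is_lie_superalgebra : Prop :=
  [/\ is_superspace,
      (forall x, linear (br x)) /\ (forall y, linear (br^~ y)),
      forall a b x y, hom a x -> hom b y -> hom (a (+) b) (br x y),
      forall a b x y, hom a x -> hom b y ->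
        br x y = - ((-1) ^+ (a && b) *: br y x)
    & forall a b x y z, hom a x -> hom b y ->
        br x (br y z) = br (br x y) z + (-1) ^+ (a && b) *: br y (br x z)].

(* x . (u (x) v) = [x, u] (x) v + (-1)^{|x||u|} u (x) [x, v] *)
Definition tact (x : V) : tens V V -> tens V V :=
  tlift (fun u v => tensor (br x u) v +
    \sum_(a : bool) \sum_(b : bool)
      (-1) ^+ (a && b) *: tensor (pr b u) (br (pr a x) v)).

Variable cobr : V -> tens V V.

Definition is_lie_superbialgebra_for : Prop :=
  is_lie_superalgebra /\
  [/\ linear cobr /\ (forall a x, cobr (pr a x) = tpr a (cobr x)),
      forall x, sflip (cobr x) = - cobr x,
      forall x, let t := tlift (fun u v => tensor u (cobr v)) (cobr x) in
        t + scycle t + scycle (scycle t) = 0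
    & forall a b x y, hom a x -> hom b y ->
        cobr (br x y) =
          tact x (cobr y) - (-1) ^+ (a && b) *: tact y (cobr x)].

(* The smallest submodule closed under the bracket and containing [S]; it is
   graded as soon as [S] consists of homogeneous elements. *)
Inductive subalg_gen (S : V -> Prop) : V -> Prop :=
| subalg_gen_gen x of S x : subalg_gen S x
| subalg_gen_zero : subalg_gen S 0
| subalg_gen_add x y of subalg_gen S x & subalg_gen S y : subalg_gen S (x + y)
| subalg_gen_scale a x of subalg_gen S x : subalg_gen S (a *: x)
| subalg_gen_br x y of subalg_gen S x & subalg_gen S y : subalg_gen S (br x y).

End Super.

(* The data of a Lie superbialgebra, without its axioms. *)
Record superbialg (k : fieldType) := SuperBialg {
  sb_car :> lmodType k;
  spr : bool -> sb_car -> sb_car;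
  sbr : sb_car -> sb_car -> sb_car;
  scobr : sb_car -> tens sb_car sb_car }.
Arguments spr {k s}.
Arguments sbr {k s}.
Arguments scobr {k s}.

Definition is_lie_superbialgebra (k : fieldType) (L : superbialg k) : Prop :=
  is_lie_superbialgebra_for (@spr k L) (@sbr k L) (@scobr k L).

Definition lsba_iso (k : fieldType) (L L' : superbialg k) : Prop :=
  [/\ is_lie_superbialgebra L, is_lie_superbialgebra L' &
      exists f : {linear L -> L'},
        [/\ bijective f,
            forall a x, f (spr a x) = spr a (f x),
            forall x y, f (sbr x y) = sbr (f x) (f y)
          & forall x, scobr (f x) =
              tlift (fun u v => tensor (f u) (f v)) (scobr x)]].

Section Deformation.
Context (k : fieldType) (L : superbialg k) (gam : L -> L -> k).

(* [x, y] - x_[1] gam(x_[2], y) - (-1)^{|x||y_[1]|} y_[1] gam(x, y_[2]) *)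
Definition deformed_br (x y : L) : L :=
  sbr x y
  - tlift (fun x1 x2 => gam x2 y *: x1) (scobr x)
  - tlift (fun y1 y2 => \sum_(a : bool) \sum_(b : bool)
             ((-1) ^+ (a && b) * gam (spr a x) y2) *: spr b y1) (scobr y).

Definition deform : superbialg k :=
  SuperBialg (@spr k L) deformed_br (@scobr k L).

End Deformation.

Inductive color := White | Black | Grey.
Definition is_white c := if c is White then true else false.
Definition is_black c := if c is Black then true else false.
Definition is_grey c := if c is Grey then true else false.

Inductive dynkin_type := tA | tB1 | tB2 | tC | tD1 | tD2 | tF4 | tG3.

(* Vertices are numbered from 0 to n-1. The boolean [de0] is the sign choice
   for the norm [(-1)^de0] of the first vector of the orthogonal basis used in
   types A, B, C and D; it has no influence on the Cartan matrix, and fixes the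
   overall sign of the symmetrizer. *)
Record diagram (n : nat) := Diagram {
  dtype : dynkin_type;
  dcol : 'I_n -> color;
  de0 : bool }.

Section Datum.
Context (n : nat) (G : diagram n).
Implicit Types g i j l : 'I_n.

Definition is_diagram : Prop :=
  match dtype G with
  | tA => (0 < n)%N /\ forall i, ~~ is_black (dcol G i)
  | tB1 => (0 < n)%N /\ forall i,
      if i.+1 == n then is_white (dcol G i) else ~~ is_black (dcol G i)
  | tB2 => (0 < n)%N /\ forall i,
      if i.+1 == n then is_black (dcol G i) else ~~ is_black (dcol G i)
  | tC => (1 < n)%N /\ forall i,
      if i.+1 == n then is_white (dcol G i) else ~~ is_black (dcol G i)
  | tD1 => (2 < n)%N /\ forall i,
      if (n <= i.+2)%N then is_white (dcol G i) else ~~ is_black (dcol G i)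
  | tD2 => (2 < n)%N /\ forall i,
      if (n <= i.+2)%N then is_grey (dcol G i) else ~~ is_black (dcol G i)
  | tF4 => n = 4 /\ forall i, dcol G i = if i == 1 :> nat then Grey else White
  | tG3 => n = 3 /\ forall i, dcol G i = if i == 0 :> nat then Grey else White
  end.

Definition parity i : bool := ~~ is_white (dcol G i).

(* Norm of the basis vector [e_m], m = 0, ..., n: it changes sign exactly when
   a grey vertex is crossed. *)
Definition eps (m : nat) : int :=
  (-1) ^+ (de0 G + \sum_(i < n | (i < m) && is_grey (dcol G i)) 1)%N.

(* Coordinate of the simple root [beta i] along [e_m]. *)
Definition beta i (m : nat) : int :=
  let diff := (m == i)%:R - (m == i.+1)%:R in
  if (i.+1 < n)%N then diff else
  match dtype G with
  | tB1 | tB2 => (m == i)%:R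
  | tC => 2 * (m == i)%:R
  | tD1 | tD2 => (m == i.-1)%:R + (m == i)%:R
  | _ => diff
  end.

Definition bform i j : int := \sum_(m < n.+1) eps m * beta i m * beta j m.

(* The integer division is exact. *)
Definition cartan_classical i j : int :=
  if is_grey (dcol G i) then
    let m := if dtype G is tD2 then minn i (n - 2) else i : nat in
    eps m * bform i j
  else ((2 * bform i j) %/ bform i i)%Z.

(* In the two exceptional types, the rows and columns of the tables below are
   numbered from 1. *)
Definition cartan_F4 (i j : nat) : int :=
  match i, j with
  | 1, 1 | 3, 3 | 4, 4 => 2
  | 1, 4 | 4, 1 | 4, 3 | 3, 2 => -1
  | 3, 4 => -2
  | 2, 3 => 1
  | _, _ => 0
  end.

Definition cartan_G3 (i j : nat) : int :=
  match i, j with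
  | 2, 2 | 3, 3 => 2
  | 1, 3 => 1
  | 3, 1 | 2, 3 => -1
  | 3, 2 => -3
  | _, _ => 0
  end.

Definition cartan : 'M[int]_n :=
  \matrix_(i, j)
    match dtype G with
    | tF4 => cartan_F4 i.+1 j.+1
    | tG3 => cartan_G3 i.+1 j.+1
    | _ => cartan_classical i j
    end.

Definition is_symmetrizer (d : 'I_n -> rat) : Prop :=
  [/\ forall i, (d i != 0) && (2 * d i \is a Num.int),
      forall i j, d i * (cartan i j)%:~R = d j * (cartan j i)%:~R
    & forall i j, d i * (cartan i j)%:~R \is a Num.int].

Definition is_minimal_symmetrizer (d : 'I_n -> rat) : Prop :=
  [/\ is_symmetrizer d,
      forall d', is_symmetrizer d' -> forall i, `|d i| <= `|d' i|
    & match dtype G with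
      | tF4 | tG3 => True
      | _ => exists2 c : rat, 0 < c &
               forall i j, d i * (cartan i j)%:~R = c * (bform i j)%:~R
      end].

(* For [i < j]: the vertices [i] and [j] are joined by a simple edge. *)
Definition simple_edge (i j : nat) : bool :=
  match dtype G with
  | tA => j == i.+1
  | tB1 | tB2 | tC => (j == i.+1) && (j.+1 < n)%N
  | tD1 | tD2 => (j == i.+1) && (j.+1 < n)%N || (j == i.+2) && (j.+1 == n)
  | tF4 => (i == 0) && (j == 3) || (i == 1) && (j == 2)
  | tG3 => (i == 0) && (j == 2)
  end%N.

(* The vertices [i] and [j] are joined by a double edge, with an arrow from [i]
   to [j]. *)
Definition double_arrow (i j : nat) : bool :=
  match dtype G with
  | tB1 | tB2 => (i.+2 == n) && (j.+1 == n)
  | tC => (i.+1 == n) && (j.+2 == n)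
  | tF4 => (i == 3) && (j == 2)
  | _ => false
  end%N.

(* The subdiagrams "i simply joined to j simply joined to l" with j grey and
   i, l white or grey, and "i simply joined to j, arrow from j to l" with j grey
   and i white or grey. They are read from left to right along the numbering,
   whence [i < j < l]. In particular, in type D(I) with a grey branch vertex,
   the two end vertices together with the branch vertex are excluded: the
   corresponding relation would kill the root vector of weight [2 e_{n-3}]. *)
Definition grey_middle i j l : bool :=
  [&& (i < j < l)%N, ~~ is_black (dcol G i), is_grey (dcol G j),
      simple_edge i j &
      simple_edge j l && ~~ is_black (dcol G l) || double_arrow j l].

(* The relations among the positive generators, resp. among the negative ones,
   as elements that must vanish; [br] is the bracket. *)
Inductive serre (k : fieldType) (V : lmodType k) (br : V -> V -> V)
    (X : 'I_n -> V) : V -> Prop :=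
| serre_comm i j of cartan i j = 0 : serre br X (br (X i) (X j))
| serre_ad i j of i != j & ~~ parity i :
    serre br X (iter `|1 - cartan i j|%N (br (X i)) (X j))
| serre_grey i j l of grey_middle i j l :
    serre br X (br (br (br (X i) (X j)) (X l)) (X j))
| serre_B2 i j of dtype G = tB2 & i.+2 = n & j.+1 = n :
    serre br X (br (br (br (X i) (X j)) (X j)) (X j))
| serre_D2 i j l of dtype G = tD2 & i.+3 = n & j.+2 = n & l.+1 = n :
    serre br X (br (br (X i) (X j)) (X l) - br (br (X i) (X l)) (X j))
| serre_C3 i j l of dtype G = tC & i.+3 = n & j.+2 = n & l.+1 = n
    & is_grey (dcol G i) & is_grey (dcol G j) :
    serre br X
      (br (br (br (br (X i) (X j)) (X l)) (br (X i) (X j))) (X j))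
| serre_C4 g i j l of dtype G = tC & g.+4 = n & i.+3 = n & j.+2 = n & l.+1 = n
    & is_grey (dcol G i) & is_grey (dcol G j) :
    serre br X
      (br (br (br (br (br (br (X g) (X i)) (X j)) (X l)) (X j)) (X i)) (X j)).

End Datum.

(* The data of a realization, without its axioms. *)
Record realization_data (k : fieldType) (n : nat) := RealizationData {
  rz_h : vectType k;
  Tp : 'I_n -> rz_h;
  Tm : 'I_n -> rz_h;
  rz_alpha : 'I_n -> 'Hom(rz_h, k^o) }.

Section Realization.
Context (k : fieldType) (n : nat).
Implicit Types (P : 'M[k]_n) (R : realization_data k n).

Definition sym_cartan (G : diagram n) (d : 'I_n -> rat) : 'M[k]_n :=
  \matrix_(i, j) ratr (d i * (cartan G i j)%:~R).

Definition cartan_type (G : diagram n) (d : 'I_n -> rat) P : Prop :=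
  2^-1 *: (P + P^T) = sym_cartan G d.

Definition Ts R (i : 'I_n) : rz_h R := 2^-1 *: (Tp R i + Tm R i).

Definition is_realization P R : Prop :=
  [/\ forall i j, rz_alpha R j (Tp R i) = P i j,
      forall i j, rz_alpha R j (Tm R i) = P j i
    & free [seq Ts R i | i : 'I_n]].

Definition coroots R : seq (rz_h R) :=
  [seq Tp R i | i : 'I_n] ++ [seq Tm R i | i : 'I_n].

Definition straight R : Prop := free [seq rz_alpha R i | i : 'I_n].
Definition split_rz R : Prop := free (coroots R).
Definition minimal_rz R : Prop := vector.span (coroots R) = fullv.

Definition AltS R (chi : {biscalar (rz_h R)}) : Prop :=
  (forall x y, chi x y = - chi y x) /\
  (forall i x, chi (Ts R i) x = 0 /\ chi x (Ts R i) = 0).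

Definition deform_mx P R (chi : {biscalar (rz_h R)}) : 'M[k]_n :=
  \matrix_(i, j) (P i j + chi (Tp R i) (Tp R j)).

Definition deform_rz R (chi : {biscalar (rz_h R)}) : realization_data k n :=
  RealizationData (Tp R) (Tm R)
    (fun i => rz_alpha R i + linfun (chi^~ (Tp R i) : rz_h R -> k^o)).

End Realization.

Inductive mono (h : Type) (n : nat) :=
| MH of h | ME of 'I_n | MF of 'I_n | MBr of mono h n & mono h n.
Arguments MH {h n}.
Arguments ME {h n}.
Arguments MF {h n}.

HB.instance Definition _ h n := gen_eqMixin (mono h n).
HB.instance Definition _ h n := gen_choiceMixin (mono h n).

Section Presentation.
Context (k : fieldType) (n : nat) (G : diagram n) (d : 'I_n -> rat).
Context (R : realization_data k n).

Local Notation h := (rz_h R).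

Fixpoint mpar (m : mono h n) : bool :=
  match m with
  | MH _ => false
  | ME i | MF i => parity G i
  | MBr x y => mpar x (+) mpar y
  end.

Definition Fr : Type := {freeg (mono h n) / k}.
HB.instance Definition _ := GRing.Lmodule.on Fr.

Definition fpr (a : bool) : Fr -> Fr :=
  fglift (fun m => if mpar m == a then << m >> : Fr else 0).

Definition fbr (x y : Fr) : Fr :=
  fglift (fun m => fglift (fun m' => << MBr m m' >> : Fr) y) x.

Definition fH (T : h) : Fr := << MH T >>.
Definition fE (i : 'I_n) : Fr := << ME i >>.
Definition fF (i : 'I_n) : Fr := << MF i >>.

(* The first three families make the quotient a Lie superalgebra in which [h]
   is a vector space; the others are the defining relations. *)
Inductive relator : Fr -> Prop :=
| rel_super (m m' : mono h n) :
    relator (<< MBr m m' >> + (-1) ^+ (mpar m && mpar m') *: << MBr m' m >>)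
| rel_jacobi (m1 m2 m3 : mono h n) :
    relator (<< MBr m1 (MBr m2 m3) >>
      - (<< MBr (MBr m1 m2) m3 >>
         + (-1) ^+ (mpar m1 && mpar m2) *: << MBr m2 (MBr m1 m3) >>))
| rel_lin a T T' : relator (fH (a *: T + T') - (a *: fH T + fH T'))
| rel_HH T T' : relator (fbr (fH T) (fH T'))
| rel_HE T j : relator (fbr (fH T) (fE j) - rz_alpha R j T *: fE j)
| rel_HF T j : relator (fbr (fH T) (fF j) + rz_alpha R j T *: fF j)
| rel_EF i l : relator (fbr (fE i) (fF l)
    - (if i == l then fH ((ratr (2 * d i))^-1 *: (Tp R i + Tm R i)) else 0))
| rel_EE x of serre G fbr fE x : relator x
| rel_FF x of serre G fbr fF x : relator x.

Inductive ideal : Fr -> Prop :=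
| ideal_rel x of relator x : ideal x
| ideal_zero : ideal 0
| ideal_add x y of ideal x & ideal y : ideal (x + y)
| ideal_scale a x of ideal x : ideal (a *: x)
| ideal_brl x y of ideal x : ideal (fbr x y)
| ideal_brr x y of ideal y : ideal (fbr x y).

Definition gP : Type := quot ideal.
HB.instance Definition _ := GRing.Lmodule.on gP.

Definition gpr (a : bool) (x : gP) : gP := qpi ideal (fpr a (repr x)).
Definition gbr (x y : gP) : gP := qpi ideal (fbr (repr x) (repr y)).
Definition gH (T : h) : gP := qpi ideal (fH T).
Definition gE (i : 'I_n) : gP := qpi ideal (fE i).
Definition gF (i : 'I_n) : gP := qpi ideal (fF i).

Lemma ideal_lspan x : lspan ideal x <-> ideal x.
Proof.
split; last exact: lspan_gen.
by elim=> [y //||y z _ ? _ ?|a y _ ?];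
  [exact: ideal_zero|exact: ideal_add|exact: ideal_scale].
Qed.

Lemma ideal_qpi x y : ideal (x - y) -> qpi ideal x = qpi ideal y.
Proof. by move=> H; apply/qpi_eqP/ideal_lspan. Qed.

Lemma ideal_repr x : ideal (repr (qpi ideal x) - x).
Proof. by apply/ideal_lspan/qpi_eqP; rewrite qpi_repr. Qed.

Lemma fbr_linearl y : linear (fbr^~ y).
Proof. by move=> a u v; rewrite /fbr linearP. Qed.

Lemma fbr_linearr x : linear (fbr x).
Proof.
move=> a u v; rewrite /fbr -(freeg_sumE x).
rewrite !linear_sum -big_split /=; apply: eq_bigr => m _.
by rewrite !liftU linearP scalerDr !scalerA mulrC.
Qed.

Lemma gbrE x y : gbr (qpi ideal x) (qpi ideal y) = qpi ideal (fbr x y).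
Proof.
apply: ideal_qpi; set x' := repr _; set y' := repr _.
have -> : fbr x' y' - fbr x y = fbr (x' - x) y' + fbr x (y' - y).
  have BL u v w : fbr (u - v) w = fbr u w - fbr v w.
    by rewrite addrC -scaleN1r fbr_linearl scaleN1r addrC.
  have BR u v w : fbr u (v - w) = fbr u v - fbr u w.
    by rewrite addrC -scaleN1r fbr_linearr scaleN1r addrC.
  by rewrite BL BR addrA subrK.
apply: ideal_add; first exact/ideal_brl/ideal_repr.
exact/ideal_brr/ideal_repr.
Qed.

Lemma fpr_linear a : linear (fpr a). Proof. exact: linearP. Qed.

Lemma fprU a m : fpr a << m >> = if mpar m == a then << m >> else 0.
Proof. by rewrite /fpr liftU scale1r. Qed.

Definition fhom (a : bool) (x : Fr) : Prop :=
  forall b, fpr b x = if a == b then x else 0.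

Lemma fhomU m : fhom (mpar m) << m >>.
Proof. by move=> b; rewrite fprU. Qed.

Lemma fhomD a x y : fhom a x -> fhom a y -> fhom a (x + y).
Proof.
move=> xa ya b; rewrite -[x]scale1r fpr_linear xa ya scale1r.
by case: eqP => _; rewrite ?scaler0 ?addr0 ?scale1r.
Qed.

Lemma fhomZ a c x : fhom a x -> fhom a (c *: x).
Proof.
move=> xa b; rewrite -[c *: x]addr0 fpr_linear xa /fpr linear0 !addr0.
by case: eqP => _; rewrite ?scaler0.
Qed.

Lemma fhomB a x y : fhom a x -> fhom a y -> fhom a (x - y).
Proof. by move=> xa ya; rewrite -scaleN1r; apply/fhomD/fhomZ. Qed.

Lemma fpr0 a : fpr a 0 = 0. Proof. exact: linear0. Qed.

Lemma fhom0 a : fhom a 0.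
Proof. by move=> b; rewrite /fpr linear0; case: eqP. Qed.

Lemma fpr_fbr b x y :
  fpr b (fbr x y) = fbr (fpr false x) (fpr b y) + fbr (fpr true x) (fpr (~~ b) y).
Proof.
pose T (u v : Fr) := fbr (fpr false u) (fpr b v) + fbr (fpr true u) (fpr (~~ b) v).
pose U (u v : Fr) := fpr b (fbr u v).
have E m m' : U << m >> << m' >> = T << m >> << m' >>.
  rewrite /U /T /fbr !fprU !liftU !scale1r fprU /=.
  clear T U; case: (mpar m); case: (mpar m'); case: b;
    by rewrite ?linear0 ?liftU ?scale1r ?linear0 ?addr0 ?add0r.
have UL v : linear (U^~ v) by move=> a u u'; rewrite /U fbr_linearl fpr_linear.
have UR u : linear (U u) by move=> a v v'; rewrite /U fbr_linearr fpr_linear.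
have TL v : linear (T^~ v).
  by move=> a u u'; rewrite /T !fpr_linear !fbr_linearl scalerDr addrACA.
have TR u : linear (T u).
  by move=> a v v'; rewrite /T !fpr_linear !fbr_linearr scalerDr addrACA.
have lin0 (f : Fr -> Fr) : linear f -> f 0 = 0.
  by move=> fl; move: (fl (-1) 0 0); rewrite scaler0 addr0 scaleN1r addNr.
have ext (f g : Fr -> Fr) : linear f -> linear g ->
    (forall m, f << m >> = g << m >>) -> forall z, f z = g z.
  move=> fl gl fg z; rewrite -(freeg_sumE z); elim: (dom z) => [|m r IH].
    by rewrite big_nil !lin0.
  rewrite big_cons.
  have -> : << coeff m z *g m >> = coeff m z *: (<< m >> : Fr).
    by apply/eqP/freeg_eqP => w; rewrite coeffZ !coeffU mul1r.
  by rewrite fl gl fg IH.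
rewrite -/(U x y) -/(T x y); apply: (ext (U^~ y) (T^~ y)) => // m.
by apply: (ext (U << m >>) (T << m >>)).
Qed.

Lemma fbr0l y : fbr 0 y = 0. Proof. exact: linear0. Qed.
Lemma fbr0r x : fbr x 0 = 0.
Proof. by move: (fbr_linearr x (-1) 0 0); rewrite scaler0 addr0 scaleN1r addNr. Qed.

Lemma fhom_br a b x y : fhom a x -> fhom b y -> fhom (a (+) b) (fbr x y).
Proof.
move=> xa yb c; rewrite fpr_fbr !xa !yb.
by case: a {xa}; case: b {yb}; case: c;
  rewrite /= ?fbr0l ?fbr0r ?addr0 ?add0r.
Qed.

Lemma serre_fhom (X : 'I_n -> Fr) x :
  (forall i, fhom (parity G i) (X i)) -> serre G fbr X x -> exists a, fhom a x.
Proof.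
move=> XP.
have XB i y : (exists a, fhom a y) -> exists a, fhom a (fbr y (X i)).
  by case=> a ya; eexists; apply: fhom_br ya (XP i).
have X1 i : exists a, fhom a (X i) by eexists; exact: XP.
case=> [i j _|i j _ _|i j l _|i j _ _ _|i j l _ _ _ _|i j l _ _ _ _ _ _
       |g i j l _ _ _ _ _ _ _]; try by (do ?apply: (XB); exact: X1).
- by elim: `|_|%N => [|m [a IH]] //=; eexists; apply: fhom_br (XP i) IH.
- exists (parity G i (+) parity G j (+) parity G l); apply: fhomB.
    by do ?apply: fhom_br.
  by rewrite addbAC; do ?apply: fhom_br.
- apply: (XB); eexists; apply: fhom_br; last by apply: fhom_br.
  by apply: fhom_br => //; apply: fhom_br.
Qed.

Lemma relator_fhom x : relator x -> exists a, fhom a x.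
Proof.
have HE i : fhom (parity G i) (fE i) by exact: fhomU (ME i).
have HF i : fhom (parity G i) (fF i) by exact: fhomU (MF i).
have HH T : fhom false (fH T) by exact: fhomU (MH T).
case=> [m m'|m1 m2 m3|a T T'|T T'|T j|T j|i l|y|y].
- exists (mpar m (+) mpar m'); apply: fhomD; first exact: fhomU (MBr m m').
  by apply: fhomZ; rewrite addbC; exact: fhomU (MBr m' m).
- exists (mpar m1 (+) (mpar m2 (+) mpar m3)); apply: fhomB.
    exact: fhomU (MBr m1 (MBr m2 m3)).
  apply: fhomD; first by rewrite addbA; exact: fhomU (MBr (MBr m1 m2) m3).
  by apply: fhomZ; rewrite addbCA; exact: fhomU (MBr m2 (MBr m1 m3)).
- by exists false; apply/fhomB/fhomD/HH/fhomZ/HH/HH.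
- by exists false; apply: fhom_br (HH T) (HH T').
- by exists (parity G j); apply/fhomB/fhomZ/HE/(fhom_br (HH T) (HE j)).
- by exists (parity G j); apply/fhomD/fhomZ/HF/(fhom_br (HH T) (HF j)).
- case: eqP => [<-|_].
    exists false; apply/fhomB/HH; rewrite -(addbb (parity G i)).
    exact: fhom_br (HE i) (HF i).
  by eexists; apply/fhomB/fhom0; exact: fhom_br (HE i) (HF l).
- exact: serre_fhom.
- exact: serre_fhom.
Qed.

Lemma ideal_fpr a x : ideal x -> ideal (fpr a x).
Proof.
move=> xI; elim: xI a => {x}.
- move=> x xR a; have [b /(_ a) ->] := relator_fhom xR.
  by case: eqP => _; [exact: ideal_rel|exact: ideal_zero].
- by move=> a; rewrite (fhom0 a) eqxx; exact: ideal_zero.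
- move=> x y _ xI _ yI a; rewrite -[x]scale1r fpr_linear scale1r.
  exact: ideal_add.
- move=> c x _ xI a; rewrite -[c *: x]addr0 fpr_linear (fhom0 a).
  by case: eqP => _; rewrite addr0; exact: ideal_scale.
- by move=> x y _ xI a; rewrite fpr_fbr; apply: ideal_add; exact: ideal_brl.
- by move=> x y _ yI a; rewrite fpr_fbr; apply: ideal_add; exact: ideal_brr.
Qed.

Lemma gprE a x : gpr a (qpi ideal x) = qpi ideal (fpr a x).
Proof.
apply: ideal_qpi; set y := repr _.
have -> : fpr a y - fpr a x = fpr a (y - x).
  by rewrite [y - x]addrC -[- x]scaleN1r fpr_linear scaleN1r addrC.
exact/ideal_fpr/ideal_repr.
Qed.

Lemma gP_ind (Q : gP -> Prop) :
  (forall x : Fr, Q (qpi ideal x)) -> forall x, Q x.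
Proof. by move=> H x; rewrite -[x]qpi_repr. Qed.

Lemma qpi_linear : linear (qpi ideal).
Proof. by move=> a x y; rewrite qpiD -qscaleE. Qed.

Lemma Fr_ind (Q : Fr -> Prop) : Q 0 ->
  (forall c x y, Q x -> Q y -> Q (c *: x + y)) -> (forall m, Q << m >>) ->
  forall x, Q x.
Proof.
move=> Q0 QL QU x; rewrite -(freeg_sumE x); elim: (dom x) => [|m r IH].
  by rewrite big_nil.
rewrite big_cons.
have -> : << coeff m x *g m >> = coeff m x *: (<< m >> : Fr).
  by apply/eqP/freeg_eqP => w; rewrite coeffZ !coeffU mul1r.
exact: QL.
Qed.

Lemma fpr_pr a b x : fpr a (fpr b x) = if a == b then fpr a x else 0.
Proof.
elim/Fr_ind: x => [|c x y xE yE|m].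
- by rewrite !fpr0 if_same.
- rewrite !fpr_linear xE yE; case: eqP => // _; by rewrite scaler0 addr0.
- rewrite !fprU; case E: (mpar m); case: b; case: a;
    by rewrite /= ?fprU ?fpr0 ?E.
Qed.

Lemma fpr_sum x : fpr false x + fpr true x = x.
Proof.
elim/Fr_ind: x => [|c x y xE yE|m].
- by rewrite !fpr0 addr0.
- by rewrite !fpr_linear addrACA -scalerDr xE yE.
- by rewrite !fprU; case: (mpar m); rewrite /= ?addr0 ?add0r.
Qed.

Lemma gpr_superspace : is_superspace gpr.
Proof.
split.
- move=> a c; elim/gP_ind=> x; elim/gP_ind=> y.
  by rewrite -qpi_linear !gprE fpr_linear qpi_linear.
- move=> a b; elim/gP_ind=> x; rewrite !gprE fpr_pr.
  case: eqP => // _; apply: (addrI (qpi ideal 0)).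
  by rewrite -qpiD !addr0.
- by elim/gP_ind=> x; rewrite !gprE -qpiD fpr_sum.
Qed.

Lemma gbr_linearl y : linear (gbr^~ y).
Proof.
elim/gP_ind: y => y a; elim/gP_ind=> u; elim/gP_ind=> v /=.
by rewrite -qpi_linear !gbrE fbr_linearl qpi_linear.
Qed.

Lemma gbr_linearr x : linear (gbr x).
Proof.
elim/gP_ind: x => x a; elim/gP_ind=> u; elim/gP_ind=> v.
by rewrite -qpi_linear !gbrE fbr_linearr qpi_linear.
Qed.

Let gm (m : mono h n) : gP := qpi ideal << m >>.

Lemma gP_hom_ind (a : bool) (Q : gP -> Prop) : Q 0 ->
  (forall c x y, Q x -> Q y -> Q (c *: x + y)) ->
  (forall m, mpar m = a -> Q (gm m)) -> forall x, hom gpr a x -> Q x.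
Proof.
move=> Q0 QL Qm x; elim/gP_ind: x => x; rewrite /hom gprE => <-.
have q0 : qpi ideal 0 = 0 by apply: (addrI (qpi ideal 0)); rewrite -qpiD !addr0.
elim/Fr_ind: x => [|c x y xE yE|m]; first by rewrite fpr0 q0.
  by rewrite fpr_linear qpi_linear; exact: QL.
by rewrite fprU; case: eqP => [/Qm //|_]; rewrite q0.
Qed.

Lemma gbr0 x : (gbr 0 x = 0) * (gbr x 0 = 0).
Proof.
split; first by have /= := gbr_linearl x (-1) 0 0;
  rewrite scaler0 addr0 scaleN1r addNr.
by have /= := gbr_linearr x (-1) 0 0; rewrite scaler0 addr0 scaleN1r addNr.
Qed.

Lemma gbr_gm m m' : gbr (gm m) (gm m') = gm (MBr m m').
Proof. by rewrite /gm gbrE /fbr !liftU !scale1r. Qed.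

Lemma gbr_super m m' :
  gbr (gm m) (gm m') = - ((-1) ^+ (mpar m && mpar m') *: gbr (gm m') (gm m)).
Proof.
rewrite !gbr_gm; apply/eqP; rewrite -subr_eq0 opprK addrC -qpi_linear.
apply/eqP; rewrite addrC; transitivity (qpi ideal 0); last first.
  by apply: (addrI (qpi ideal 0)); rewrite -qpiD !addr0.
by apply: ideal_qpi; rewrite subr0; apply/ideal_rel/rel_super.
Qed.

Lemma gbr_jacobi m1 m2 m3 :
  gbr (gm m1) (gbr (gm m2) (gm m3)) =
    gbr (gbr (gm m1) (gm m2)) (gm m3) +
    (-1) ^+ (mpar m1 && mpar m2) *: gbr (gm m2) (gbr (gm m1) (gm m3)).
Proof.
rewrite !gbr_gm addrC -qpi_linear; apply: ideal_qpi; rewrite [_ *: _ + _]addrC.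
by apply/ideal_rel/rel_jacobi.
Qed.

Lemma gP_lie_superalgebra : is_lie_superalgebra gpr gbr.
Proof.
split; first exact: gpr_superspace.
- by split; [exact: gbr_linearr | exact: gbr_linearl].
- move=> a b; elim/gP_ind=> x; elim/gP_ind=> y.
  rewrite /hom (gprE a) (gprE b) gbrE gprE => xa yb.
  rewrite -gprE -gbrE -xa -yb gbrE gprE; congr qpi.
  by rewrite (@fhom_br a b) ?eqxx // => c; rewrite fpr_pr eq_sym;
    case: eqP => // ->.
- move=> a b x y xa yb; elim/(gP_hom_ind (a := a)): x / xa.
  + by rewrite !gbr0 scaler0 oppr0.
  + move=> c u v uE vE; rewrite gbr_linearl gbr_linearr uE vE.
    by rewrite !scalerDr opprD !scalerN !scalerA mulrC.
  move=> m <-; elim/(gP_hom_ind (a := b)): y / yb.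
  + by rewrite !gbr0 scaler0 oppr0.
  + move=> c u v uE vE; rewrite gbr_linearl gbr_linearr uE vE.
    by rewrite !scalerDr opprD !scalerN !scalerA mulrC.
  by move=> m' <-; exact: gbr_super.
- move=> a b x y z xa yb; elim/(gP_hom_ind (a := a)): x / xa.
  + by rewrite !gbr0 scaler0 addr0.
  + move=> c u v uE vE; rewrite !gbr_linearl uE vE gbr_linearr.
    by rewrite !scalerDr !scalerA mulrC addrACA.
  move=> m <-; elim/(gP_hom_ind (a := b)): y / yb.
  + by rewrite !gbr0 scaler0 addr0.
  + move=> c u v uE vE; rewrite !(gbr_linearl, gbr_linearr) uE vE.
    by rewrite !scalerDr !scalerA mulrC addrACA.
  move=> m' <-; elim/gP_ind: z => z; elim/Fr_ind: z => [|c u v uE vE|m''].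
  + have -> : qpi ideal 0 = 0 by apply: (addrI (qpi ideal 0));
      rewrite -qpiD !addr0.
    by rewrite !gbr0 scaler0 addr0.
  + rewrite qpi_linear !gbr_linearr uE vE.
    by rewrite !scalerDr !scalerA mulrC addrACA.
  by rewrite gbr_jacobi.
Qed.

Definition npos : gP -> Prop := subalg_gen gbr (fun x => exists i, x = gE i).
Definition nneg : gP -> Prop := subalg_gen gbr (fun x => exists i, x = gF i).

(* The projection onto [h] of the decomposition n_+ (+) h (+) n_-; the latter
   being the whole space, [pi] is determined by this property. *)
Definition is_triangular_projection (pi : gP -> h) : Prop :=
  forall u T v, npos u -> nneg v -> pi (u + gH T + v) = T.

Definition toral (chi : {biscalar h}) (pi : gP -> h) (x y : gP) : k :=
  chi (pi x) (pi y).

Definition gP_superbialg (cobr : gP -> tens gP gP) : superbialg k :=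
  SuperBialg gpr gbr cobr.

(* The multiparameter Lie superbialgebra: the Lie superalgebra [gP] with its
   cobracket. The latter is determined by its values on the generators, by the
   cocycle condition. *)
Record mplsba := Mplsba {
  mp_cobr : gP -> tens gP gP;
  mp_lie_superbialgebra : is_lie_superbialgebra (gP_superbialg mp_cobr);
  mp_cobrH : forall T, mp_cobr (gH T) = 0;
  mp_cobrE : forall i,
    mp_cobr (gE i) = 2 *: wedge gpr (gH (Tp R i)) (gE i);
  mp_cobrF : forall i,
    mp_cobr (gF i) = 2 *: wedge gpr (gH (Tm R i)) (gF i) }.

Definition mp_superbialg (L : mplsba) : superbialg k :=
  gP_superbialg (mp_cobr L).

End Presentation.

Coercion mp_superbialg : mplsba >-> superbialg.

(* Main.v *)
From HB Require Import structures.
Require Import Defs.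
From mathcomp Require Import all_boot all_order all_algebra.
From mathcomp Require Import boolp freeg ring.

Set Implicit Arguments.
Unset Strict Implicit.
Unset Printing Implicit Defensive.

Import GRing.Theory.
Local Open Scope ring_scope.
Local Notation hom := Defs.hom.

(** Write [g] for the Lie superbialgebra attached to [P] and a realization with
    Cartan space [h].  The root lattice grades [g], and a linear form [c] on the
    root lattice gives the derivation [wdeg c], which multiplies an element of
    degree [mu] by [c mu].

    A linear form [lam] on [h] killing every [S_i] extends to a character
    [toral_char lam] of [g] that is zero on the Chevalley generators: the only
    constraint comes from [[E_i, F_i]], a multiple of [S_i].  The computation on
    which everything rests is [contract_cobr]: applying such a character to the
    second leg of the cobracket is a derivation of [g], by the cocycle condition,
    hence it is determined on the generators, where it is [- wdeg (lam o T^+)].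

    The toral cocycle is made of such characters, since the projection onto [h]
    followed by [lam] is [toral_char lam] ([toral_char_projection], which needs
    [g = n_+ + h + n_-]).  So the deformed bracket is
    [[x, y] - B x y + B y x], where [B x] is the derivation [wdeg] along the
    values on [x] of the characters attached to [chi] ([deformed_brE]).  The maps
    [B x] are commuting even derivations and [B] kills brackets and its own
    values in its first argument; this is all the Jacobi identity for the new
    bracket needs ([twist_lie_superalgebra]).  That the old cobracket is a
    cocycle for the new bracket holds since on homogeneous [x], [y] of degrees
    [mu], [nu] the two corrections [chi(T_mu, T_nu) (x (x) y - y (x) x)], up to
    signs, cancel ([twist_cocycle_at]).

    With the deformed bracket, the generators of [g] satisfy the relations of the
    realization with roots [alpha_j + chi(-, T_j^+)], because all Serre relations
    only involve elements on which [B] vanishes.  The universal property gives a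
    morphism to the deformation.  The same construction with [- chi] goes back,
    and twisting twice by opposite forms restores the bracket, so the two
    morphisms are mutually inverse ([twisted_homK]).  Cobrackets agree on
    generators, hence everywhere.  This is [toral_deformation_iso]; it is proved
    for any second realization identified with the deformed one by an isomorphism
    of Cartan spaces.

    If the [T_i^+], [T_i^-] are linearly independent, an antisymmetric form
    vanishing on the [S_i] may take any antisymmetric matrix of values on the
    [T_i^+], and [P' - P] is antisymmetric when [P] and [P'] have the same
    symmetric part.  In the split minimal case the coroots are bases of the two
    Cartan spaces and give the isomorphism between them. *)

(** * Linear identities *)

(** Linear identities in a module are identities in the square-zero extension
    [k + V], a commutative ring where [V * V = 0]; the [ring] tactic decides
    them there. *)
Section SquareZero.
Context (k : fieldType) (V : lmodType k).

Definition sqz : Type := (k * V)%type.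
HB.instance Definition _ := GRing.Zmodule.on sqz.

Definition sqz_one : sqz := (1, 0).
Definition sqz_mul (x y : sqz) : sqz := (x.1 * y.1, x.1 *: y.2 + y.1 *: x.2).

Lemma sqz_mulA : associative sqz_mul.
Proof.
move=> [a x] [b y] [c z]; congr pair => /=; first by rewrite mulrA.
by rewrite !scalerDr !scalerA addrA (mulrC c a) (mulrC c b).
Qed.
Lemma sqz_mulC : commutative sqz_mul.
Proof. by move=> [a x] [b y]; congr pair => /=; [exact: mulrC|exact: addrC]. Qed.
Lemma sqz_mul1 : left_id sqz_one sqz_mul.
Proof. by move=> [a x]; rewrite /sqz_mul /= mul1r scale1r scaler0 addr0. Qed.
Lemma sqz_mulDl : left_distributive sqz_mul +%R.
Proof.
move=> [a x] [b y] [c z]; congr pair => /=; first exact: mulrDl.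
by rewrite scalerDl scalerDr addrACA.
Qed.
Lemma sqz_one_neq0 : sqz_one != 0.
Proof. by apply/eqP => -[] /eqP; rewrite oner_eq0. Qed.
HB.instance Definition _ := GRing.Zmodule_isComNzRing.Build sqz
  sqz_mulA sqz_mulC sqz_mul1 sqz_mulDl sqz_one_neq0.

Definition sqz_cst (a : k) : sqz := (a, 0).
Definition sqz_vec (v : V) : sqz := (0, v).

Lemma sqz_cst_zmod : zmod_morphism sqz_cst.
Proof. by move=> a b; congr pair; rewrite subr0. Qed.
HB.instance Definition _ := GRing.isZmodMorphism.Build k sqz sqz_cst sqz_cst_zmod.
Lemma sqz_cst_monoid : monoid_morphism sqz_cst.
Proof. by split=> // a b; congr pair; rewrite /= !scaler0 addr0. Qed.
HB.instance Definition _ := GRing.isMonoidMorphism.Build k sqz sqz_cst sqz_cst_monoid.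

Lemma sqz_vec0 : sqz_vec 0 = 0. Proof. by []. Qed.
Lemma sqz_vecD u v : sqz_vec (u + v) = sqz_vec u + sqz_vec v.
Proof. by congr pair; rewrite /= addr0. Qed.
Lemma sqz_vecN u : sqz_vec (- u) = - sqz_vec u.
Proof. by congr pair; rewrite /= oppr0. Qed.
Lemma sqz_vecZ a v : sqz_vec (a *: v) = sqz_cst a * sqz_vec v.
Proof. by congr pair; rewrite /= ?mulr0 ?scaler0 ?scale0r ?addr0. Qed.
Lemma sqz_vec_inj : injective sqz_vec.
Proof. by move=> u v []. Qed.
End SquareZero.

Ltac module :=
  apply: sqz_vec_inj; rewrite ?(sqz_vecZ, sqz_vecD, sqz_vecN, sqz_vec0); ring.

(** * Linear maps and tensor products *)

Section Linear.
Context (k : fieldType).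

Section OneMap.
Context (U W : lmodType k) (f : U -> W).
Hypothesis fL : linear f.
Lemma lin0 : f 0 = 0.
Proof. by have := fL (-1) 0 0; rewrite scaler0 addr0 scaleN1r addNr. Qed.
Lemma linD x y : f (x + y) = f x + f y.
Proof. by rewrite -[x in LHS]scale1r fL scale1r. Qed.
Lemma linZ a x : f (a *: x) = a *: f x.
Proof. by rewrite -[a *: x]addr0 fL lin0 addr0. Qed.
Lemma linN x : f (- x) = - f x.
Proof. by rewrite -scaleN1r linZ scaleN1r. Qed.
Lemma linB x y : f (x - y) = f x - f y.
Proof. by rewrite linD linN. Qed.
End OneMap.

Lemma linear_comp (U V W : lmodType k) (f : V -> W) (g : U -> V) :
  linear f -> linear g -> linear (fun x => f (g x)).
Proof. by move=> fL gL a x y; rewrite gL fL. Qed.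

Lemma linear_ext (U V : lmodType k) (f g : U -> V) :
  f =1 g -> linear g -> linear f.
Proof. by move=> fg gL a x y; rewrite !fg gL. Qed.

Lemma linear_add (U V : lmodType k) (f g : U -> V) :
  linear f -> linear g -> linear (fun x => f x + g x).
Proof. by move=> fL gL a x y; rewrite fL gL scalerDr addrACA. Qed.

Lemma linear_scale (U V : lmodType k) (c : k) (f : U -> V) :
  linear f -> linear (fun x => c *: f x).
Proof. by move=> fL a x y; rewrite fL scalerDr !scalerA mulrC. Qed.

Lemma linear_opp (U V : lmodType k) (f : U -> V) :
  linear f -> linear (fun x => - f x).
Proof. by move=> fL a x y; rewrite fL opprD scalerN. Qed.

Lemma linear_big (U V : lmodType k) (I : finType) (F : I -> U -> V) :
  (forall i, linear (F i)) -> linear (fun x => \sum_i F i x).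
Proof.
move=> FL a x y; rewrite scaler_sumr -big_split.
by apply: eq_bigr => i _; exact: FL.
Qed.

Definition bilin (U V W : lmodType k) (B : U -> V -> W) : Prop :=
  (forall v, linear (B^~ v)) /\ (forall u, linear (B u)).

Lemma bilin_add (U V W : lmodType k) (B C : U -> V -> W) :
  bilin B -> bilin C -> bilin (fun u v => B u v + C u v).
Proof. by move=> [B1 B2] [C1 C2]; split=> w; exact: linear_add. Qed.

Lemma bilin_scale (U V W : lmodType k) (c : k) (B : U -> V -> W) :
  bilin B -> bilin (fun u v => c *: B u v).
Proof. by move=> [B1 B2]; split=> w; exact: linear_scale. Qed.

Lemma bilin_sum (U V W : lmodType k) (I : finType) (B : I -> U -> V -> W) :
  (forall i, bilin (B i)) -> bilin (fun u v => \sum_i B i u v).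
Proof. by move=> BL; split=> w; apply: linear_big => i; case: (BL i). Qed.

Lemma bilin_comp (U V U' V' W : lmodType k) (B : U -> V -> W) f g :
  bilin B -> linear f -> linear g ->
  bilin (fun (u : U') (v : V') => B (f u) (g v)).
Proof. by move=> [B1 B2] fL gL; split=> w a u v; rewrite ?fL ?gL ?B1 ?B2. Qed.

Lemma bilin_flip (U V W : lmodType k) (B : U -> V -> W) :
  bilin B -> bilin (fun v u => B u v).
Proof. by case. Qed.

Lemma freeg_ind (K : choiceType) (Q : {freeg K / k} -> Prop) : Q 0 ->
  (forall c x y, Q x -> Q y -> Q (c *: x + y)) -> (forall m, Q << m >>) ->
  forall x, Q x.
Proof.
move=> Q0 QL QU x; rewrite -(freeg_sumE x); elim: (dom x) => [|m r IH].
  by rewrite big_nil.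
rewrite big_cons.
have -> : << coeff m x *g m >> = coeff m x *: (<< m >> : {freeg K / k}).
  by apply/eqP/freeg_eqP => w; rewrite coeffZ !coeffU mul1r.
exact: QL.
Qed.

Lemma qpiP (V : lmodType k) (S : V -> Prop) : linear (qpi S).
Proof. by move=> a x y; rewrite qpiD -qscaleE. Qed.

Lemma quot_ind (V : lmodType k) (S : V -> Prop) (Q : quot S -> Prop) :
  (forall x, Q (qpi S x)) -> forall x, Q x.
Proof. by move=> H x; rewrite -[x]qpi_repr. Qed.

Section TensorMaps.
Context (V W : lmodType k).

Lemma tensor_bilin : bilin (@tensor k V W).
Proof.
split=> [w a u v|v a u w]; rewrite /tensor -!(qpiP _ a); apply/qpi_eqP/lspan_gen.
  exact: bilinear_rel_l.
exact: bilinear_rel_r.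
Qed.

Lemma tensorPl w a u v :
  tensor (a *: u + v) w = a *: tensor u w + tensor v w :> tens V W.
Proof. exact: tensor_bilin.1. Qed.
Lemma tensorPr v a u w :
  tensor v (a *: u + w) = a *: tensor v u + tensor v w :> tens V W.
Proof. exact: tensor_bilin.2. Qed.
Lemma tensor0l w : tensor 0 w = 0 :> tens V W.
Proof. exact: lin0 (tensor_bilin.1 w). Qed.
Lemma tensor0r v : tensor v 0 = 0 :> tens V W.
Proof. exact: lin0 (tensor_bilin.2 v). Qed.
Lemma tensorDl w u v : tensor (u + v) w = tensor u w + tensor v w :> tens V W.
Proof. exact: linD (tensor_bilin.1 w) u v. Qed.
Lemma tensorDr v u w : tensor v (u + w) = tensor v u + tensor v w :> tens V W.
Proof. exact: linD (tensor_bilin.2 v) u w. Qed.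
Lemma tensorZl w a u : tensor (a *: u) w = a *: tensor u w :> tens V W.
Proof. exact: linZ (tensor_bilin.1 w) a u. Qed.
Lemma tensorZr v a u : tensor v (a *: u) = a *: tensor v u :> tens V W.
Proof. exact: linZ (tensor_bilin.2 v) a u. Qed.
Lemma tensorNl w u : tensor (- u) w = - tensor u w :> tens V W.
Proof. exact: linN (tensor_bilin.1 w) u. Qed.
Lemma tensorNr v u : tensor v (- u) = - tensor v u :> tens V W.
Proof. exact: linN (tensor_bilin.2 v) u. Qed.

Lemma tens_ind (Q : tens V W -> Prop) : Q 0 ->
  (forall c x y, Q x -> Q y -> Q (c *: x + y)) ->
  (forall v w, Q (tensor v w)) -> forall t, Q t.
Proof.
move=> Q0 QL QT; apply: quot_ind; apply: freeg_ind => [|c x y Qx Qy|[v w]].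
- by rewrite (lin0 (qpiP _)).
- by rewrite qpiP; exact: QL.
- exact: QT.
Qed.

Lemma tens_ext (U : lmodType k) (f g : tens V W -> U) : linear f -> linear g ->
  (forall v w, f (tensor v w) = g (tensor v w)) -> f =1 g.
Proof.
move=> fL gL fg; elim/tens_ind => [|c x y xE yE|//].
  by rewrite (lin0 fL) (lin0 gL).
by rewrite fL gL xE yE.
Qed.

Section Lift.
Context (U : lmodType k) (B : V -> W -> U).
Hypothesis BL : bilin B.

Lemma tlift_qpi x : tlift B (qpi _ x) = fglift (fun vw => B vw.1 vw.2) x.
Proof.
rewrite /tlift qliftE // => _ [a v1 v2 w1|a v1 w1 w2].
- rewrite linearB linearD linearZ /= !liftU !scale1r /=.
  by rewrite (BL.1 w1 a v1 v2) subrr.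
- rewrite linearB linearD linearZ /= !liftU !scale1r /=.
  by rewrite (BL.2 v1 a w1 w2) subrr.
Qed.

Lemma tliftT v w : tlift B (tensor v w) = B v w.
Proof. by rewrite /tensor tlift_qpi liftU scale1r. Qed.

Lemma tliftP : linear (tlift B).
Proof.
move=> a; apply: quot_ind => x; apply: quot_ind => y.
by rewrite -qpiP !tlift_qpi linearP.
Qed.
End Lift.

End TensorMaps.

Definition tmap (V W V' W' : lmodType k) (f : V -> V') (g : W -> W') :
  tens V W -> tens V' W' := tlift (fun u v => tensor (f u) (g v)).

Section Tmap.
Context (V W V' W' : lmodType k) (f : V -> V') (g : W -> W').
Hypotheses (fL : linear f) (gL : linear g).
Lemma tmap_bilin : bilin (fun u v => tensor (f u) (g v)).
Proof. by split=> w a u v; rewrite ?fL ?gL ?tensorPl ?tensorPr. Qed.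
Lemma tmapT u v : tmap f g (tensor u v) = tensor (f u) (g v).
Proof. exact: tliftT tmap_bilin u v. Qed.
Lemma tmapP : linear (tmap f g). Proof. exact: tliftP tmap_bilin. Qed.
End Tmap.

End Linear.

Lemma sum_bool (W : nmodType) (F : bool -> W) :
  \sum_(a : bool) F a = F false + F true.
Proof. by rewrite big_bool addrC. Qed.

(** * Tensors over a superspace *)

Section Superspace.
Context (k : fieldType) (V : lmodType k) (pr : bool -> V -> V).
Hypothesis HS : is_superspace pr.

Lemma prP a : linear (pr a). Proof. by case: HS. Qed.
Lemma pr_hom a x : hom pr a (pr a x).
Proof. by case: HS => _ /(_ a a x) + _; rewrite eqxx. Qed.
Lemma homE a b x : hom pr a x -> pr b x = if b == a then x else 0.
Proof.
move=> xa; case: HS => _ /(_ b a x) + _; rewrite xa => ->.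
by case: eqP => [->|].
Qed.
Lemma hom0 a : hom pr a 0. Proof. exact: lin0 (prP a). Qed.
Lemma homD a x y : hom pr a x -> hom pr a y -> hom pr a (x + y).
Proof. by rewrite /hom (linD (prP a)) => -> ->. Qed.
Lemma homZ a c x : hom pr a x -> hom pr a (c *: x).
Proof. by rewrite /hom (linZ (prP a)) => ->. Qed.
Lemma homN a x : hom pr a x -> hom pr a (- x).
Proof. by rewrite -scaleN1r; exact: homZ. Qed.

Lemma parity_ind (Q : V -> Prop) :
  (forall c x y, Q x -> Q y -> Q (c *: x + y)) ->
  (forall a x, hom pr a x -> Q x) -> forall x, Q x.
Proof.
move=> QL Qh x; case: HS => _ _ /(_ x) <-; rewrite -[pr false x]scale1r.
by apply: QL; apply: Qh; exact: pr_hom.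
Qed.

(** On homogeneous tensors the sign rules become explicit scalars, so that maps
    are compared there. *)
Lemma tens_hom_ext (U : lmodType k) (f g : tens V V -> U) :
  linear f -> linear g ->
  (forall a b v w, hom pr a v -> hom pr b w ->
     f (tensor v w) = g (tensor v w)) -> f =1 g.
Proof.
move=> fL gL fg; apply: tens_ext => // v w; move: v w.
elim/parity_ind => [c x y IHx IHy w|a v va].
  by rewrite tensorPl fL gL IHx IHy.
elim/parity_ind => [c x y IHx IHy|b w wb]; last exact: fg va wb.
by rewrite tensorPr fL gL IHx IHy.
Qed.

Lemma tens3_hom_ext (U : lmodType k) (f g : tens V (tens V V) -> U) :
  linear f -> linear g ->
  (forall a b c u v w, hom pr a u -> hom pr b v -> hom pr c w ->
     f (tensor u (tensor v w)) = g (tensor u (tensor v w))) -> f =1 g.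
Proof.
move=> fL gL fg; apply: tens_ext => // u t; move: u t.
elim/parity_ind => [c x y IHx IHy w|a u ua t].
  by rewrite tensorPl fL gL IHx IHy.
apply: (@tens_hom_ext _ (fun t => f (tensor u t)) (fun t => g (tensor u t))).
- by move=> c x y; rewrite tensorPr fL.
- by move=> c x y; rewrite tensorPr gL.
- by move=> b c v w vb wc; exact: fg ua vb wc.
Qed.

Lemma sflip_bilin : bilin (fun u v => \sum_(a : bool) \sum_(b : bool)
  (-1) ^+ (a && b) *: tensor (pr b v) (pr a u)).
Proof.
apply: bilin_sum => a; apply: bilin_sum => b; apply: bilin_scale.
exact: bilin_flip (bilin_comp (tensor_bilin V V) (prP b) (prP a)).
Qed.
Lemma sflipP : linear (sflip pr). Proof. exact: tliftP sflip_bilin. Qed.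
Lemma sflipT a b u v : hom pr a u -> hom pr b v ->
  sflip pr (tensor u v) = (-1) ^+ (a && b) *: tensor v u.
Proof.
move=> ua vb; rewrite /sflip (tliftT sflip_bilin) !sum_bool.
rewrite !(homE _ ua) !(homE _ vb).
by case: a {ua}; case: b {vb};
  rewrite /= ?(tensor0l, tensor0r, scaler0, addr0, add0r).
Qed.

Lemma tpr_bilin a : bilin (fun u v => \sum_(b : bool)
  tensor (pr b u) (pr (a (+) b) v)).
Proof.
by apply: bilin_sum => b; exact: bilin_comp (tensor_bilin V V) (prP _) (prP _).
Qed.
Lemma tprP a : linear (tpr pr a). Proof. exact: tliftP (tpr_bilin a). Qed.
Lemma tprT c a b u v : hom pr a u -> hom pr b v ->
  tpr pr c (tensor u v) = if c == a (+) b then tensor u v else 0.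
Proof.
move=> ua vb; rewrite /tpr (tliftT (tpr_bilin c)) !sum_bool.
rewrite !(homE _ ua) !(homE _ vb).
by case: a {ua}; case: b {vb}; case: c; rewrite /= ?tensor0l ?tensor0r ?addr0 ?add0r.
Qed.

Lemma scycle_bilin2 u : bilin (fun v w =>
    \sum_(a : bool) \sum_(b : bool) \sum_(c : bool)
      (-1) ^+ (a && (b (+) c)) *:
        tensor (pr b v) (tensor (pr c w) (pr a u))).
Proof.
do 3 apply: bilin_sum => ?; apply: bilin_scale; split=> w c x y.
  by rewrite prP tensorPl.
by rewrite prP tensorPl tensorPr.
Qed.
Lemma scycle_bilin : bilin (fun u vw => tlift (fun v w =>
    \sum_(a : bool) \sum_(b : bool) \sum_(c : bool)
      (-1) ^+ (a && (b (+) c)) *: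
        tensor (pr b v) (tensor (pr c w) (pr a u))) vw).
Proof.
split=> [t|u]; last exact: tliftP (scycle_bilin2 u).
elim/tens_ind: t => [|e s t IHs IHt|v w].
- by move=> c x y; rewrite !(lin0 (tliftP (scycle_bilin2 _))) scaler0 addr0.
- apply: linear_ext (linear_add (linear_scale e IHs) IHt) => u.
  exact: tliftP (scycle_bilin2 u) e s t.
apply: linear_ext (fun u => tliftT (scycle_bilin2 u) v w) _.
cbv beta.
do 3 apply: linear_big => ?; apply: linear_scale => c x y.
by rewrite prP !tensorPr.
Qed.
Lemma scycleP : linear (scycle pr). Proof. exact: tliftP scycle_bilin. Qed.
Lemma scycleT a b c u v w : hom pr a u -> hom pr b v -> hom pr c w ->
  scycle pr (tensor u (tensor v w)) =
    (-1) ^+ (a && (b (+) c)) *: tensor v (tensor w u).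
Proof.
move=> ua vb wc.
rewrite /scycle (tliftT scycle_bilin) (tliftT (scycle_bilin2 _)) !sum_bool.
rewrite !(homE _ ua) !(homE _ vb) !(homE _ wc).
by case: a {ua}; case: b {vb}; case: c {wc};
  rewrite /= ?(tensor0l, tensor0r, scaler0, addr0, add0r).
Qed.

Section Bracket.
Variable br : V -> V -> V.
Hypothesis brL : bilin br.

Lemma tact_bilin x : bilin (fun u v => tensor (br x u) v +
    \sum_(a : bool) \sum_(b : bool)
      (-1) ^+ (a && b) *: tensor (pr b u) (br (pr a x) v)).
Proof.
apply: bilin_add.
  by split=> w c u v; rewrite ?(brL.2 x) ?(tensorPl, tensorPr).
do 2 apply: bilin_sum => ?; apply: bilin_scale.
exact: bilin_comp (tensor_bilin V V) (prP _) (brL.2 _).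
Qed.
Lemma tactP x : linear (tact pr br x). Proof. exact: tliftP (tact_bilin x). Qed.
Lemma tactT c a x u v : hom pr c x -> hom pr a u ->
  tact pr br x (tensor u v) =
    tensor (br x u) v + (-1) ^+ (c && a) *: tensor u (br x v).
Proof.
move=> xc ua; rewrite /tact (tliftT (tact_bilin x)) !sum_bool.
rewrite !(homE _ ua) !(homE _ xc).
by case: a {ua}; case: c {xc};
  rewrite /= ?(lin0 (brL.1 _)) ?(tensor0l, tensor0r, scaler0, addr0, add0r).
Qed.
Lemma tact_linl t : linear (fun x => tact pr br x t).
Proof.
elim/tens_ind: t => [|e s t IHs IHt|v w].
- by move=> c x y; rewrite !(lin0 (tactP _)) scaler0 addr0.
- apply: linear_ext (linear_add (linear_scale e IHs) IHt) => x.
  exact: tactP x e s t.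
apply: linear_ext (fun x => tliftT (tact_bilin x) v w) _.
cbv beta.
apply: linear_add => [c x y|]; first by rewrite (brL.1 v) tensorPl.
do 2 apply: linear_big => ?; apply: linear_scale => c x y.
by rewrite prP (brL.1 w) tensorPr.
Qed.

(** Contraction of the second leg with a linear form [q]; when [q] kills
    brackets, it turns the action on tensors into the bracket. *)
Section Contract.
Variable q : V -> k^o.
Hypothesis qL : linear q.

Definition contract : tens V V -> V := tlift (fun u v => (q v : k) *: u).
Lemma contract_bilin : bilin (fun u v : V => (q v : k) *: u).
Proof.
split=> [v|u] a x y; first by rewrite scalerDr !scalerA mulrC.
by rewrite qL scalerDl scalerA.
Qed.
Lemma contractP : linear contract. Proof. exact: tliftP contract_bilin. Qed.
Lemma contractT u v : contract (tensor u v) = (q v : k) *: u.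
Proof. exact: tliftT contract_bilin u v. Qed.

Lemma contract_wedge t e : q e = 0 ->
  contract (tensor t e - tensor e t) = - ((q t : k) *: e).
Proof.
by move=> qe; rewrite (linB contractP) !contractT qe scale0r sub0r.
Qed.

Hypothesis q_br : forall x y, q (br x y) = 0.

Lemma contract_tact x t : contract (tact pr br x t) = br x (contract t).
Proof.
elim/parity_ind: x t => [e x y IHx IHy t|a x xa].
  by rewrite tact_linl contractP IHx IHy brL.1.
apply: tens_hom_ext => [||b b' u v ub vb'].
- exact: linear_comp contractP (tactP x).
- exact: linear_comp (brL.2 x) contractP.
rewrite (tactT v xa ub) (linD contractP) (linZ contractP) !contractT.
by rewrite q_br scale0r scaler0 addr0 (linZ (brL.2 x)).
Qed.
End Contract.

(** The extension of an even derivation to tensors by the Leibniz rule. *)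
Section Derivation.
Variable D : V -> V.
Hypothesis DL : linear D.

Definition tder : tens V V -> tens V V :=
  tlift (fun u v => tensor (D u) v + tensor u (D v)).
Lemma tder_bilin : bilin (fun u v : V => tensor (D u) v + tensor u (D v)).
Proof.
have idL : linear (@id V) by [].
apply: bilin_add.
  exact: bilin_comp (tensor_bilin V V) DL idL.
exact: bilin_comp (tensor_bilin V V) idL DL.
Qed.
Lemma tderP : linear tder. Proof. exact: tliftP tder_bilin. Qed.
Lemma tderT u v : tder (tensor u v) = tensor (D u) v + tensor u (D v).
Proof. exact: tliftT tder_bilin u v. Qed.

Lemma tder_wedge c t e : D t = 0 -> D e = c *: e ->
  tder (tensor t e - tensor e t) = c *: (tensor t e - tensor e t).
Proof.
move=> Dt De; rewrite (linB tderP) !tderT Dt De !tensor0l !tensor0r.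
by rewrite tensorZl tensorZr add0r addr0 scalerBr.
Qed.

Hypothesis D_pr : forall a x, D (pr a x) = pr a (D x).
Hypothesis D_br : forall x y, D (br x y) = br (D x) y + br x (D y).

Lemma tder_tact x t :
  tder (tact pr br x t) = tact pr br (D x) t + tact pr br x (tder t).
Proof.
elim/parity_ind: x t => [e x y IHx IHy t|a x xa].
  by rewrite DL !tact_linl tderP IHx IHy scalerDr addrACA.
apply: tens_hom_ext => [||b b' u v ub vb'].
- exact: linear_comp tderP (tactP x).
- exact: linear_add (tactP (D x)) (linear_comp (tactP x) tderP).
have Dhom c y : hom pr c y -> hom pr c (D y) by rewrite /hom -D_pr => ->.
rewrite (tactT v xa ub) (linD tderP) (linZ tderP) !tderT.
rewrite (tactT v (Dhom _ _ xa) ub) (linD (tactP x)).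
rewrite (tactT v xa (Dhom _ _ ub)) (tactT _ xa ub).
rewrite !D_br !(tensorDl, tensorDr).
have shuffle (W : lmodType k) (e : k) (t1 t2 t3 t4 t5 t6 : W) :
    t1 + t2 + t3 + e *: (t4 + (t5 + t6)) =
    t1 + e *: t5 + (t2 + e *: t4 + (t3 + e *: t6)) by module.
exact: shuffle.
Qed.

(** The induction step showing that a cobracket preserves weights: an expression
    of the cocycle type in two eigenvectors is an eigenvector for the sum of the
    weights. *)
Lemma tder_cocycle w w' s x y cx cy :
  D x = w *: x -> D y = w' *: y -> tder cx = w *: cx -> tder cy = w' *: cy ->
  tder (tact pr br x cy - s *: tact pr br y cx) =
    (w + w') *: (tact pr br x cy - s *: tact pr br y cx).
Proof.
move=> Dx Dy Dcx Dcy; rewrite (linB tderP) (linZ tderP) !tder_tact Dx Dy Dcx Dcy.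
rewrite !(linZ (tact_linl _)) !(linZ (tactP _)).
have shuffle (W : lmodType k) (t t' : W) :
    w *: t + w' *: t - s *: (w' *: t' + w *: t') = (w + w') *: (t - s *: t').
  by module.
exact: shuffle.
Qed.
End Derivation.
End Bracket.

(** The sign automorphism of the superspace, or the identity: it absorbs the sign
    created by moving an element of parity [a] past [u]. *)
Definition signed (a : bool) (u : V) : V := pr false u + (-1) ^+ a *: pr true u.
Lemma signedP a : linear (signed a).
Proof. exact: linear_add (prP false) (linear_scale _ (prP true)). Qed.
Lemma signedE a b u : hom pr b u -> signed a u = (-1) ^+ (a && b) *: u.
Proof.
move=> ub; rewrite /signed !(homE _ ub); case: b {ub}; case: a => /=;
  by rewrite ?(scaler0, addr0, add0r, expr0, scale1r).
Qed.

End Superspace.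

(** * Twisting a Lie superalgebra by commuting derivations *)

(** The map [x |-> x - B x] into the semidirect product of the Lie superalgebra
    with the commuting derivations [B x] sends the twisted bracket to the
    commutator, because [B] is zero on brackets and on its own values. *)
Section Twist.
Context (k : fieldType) (V : lmodType k).
Context (pr : bool -> V -> V) (br : V -> V -> V) (B : V -> V -> V).
Hypothesis LV : is_lie_superalgebra pr br.
Hypothesis BL : bilin B.
Hypothesis B_pr : forall a x y, B x (pr a y) = pr a (B x y).
Hypothesis B_der : forall x y z, B x (br y z) = br (B x y) z + br y (B x z).
Hypothesis B_br : forall x y z, B (br x y) z = 0.
Hypothesis B_B : forall x y z, B (B x y) z = 0.
Hypothesis B_odd : forall x y, B (pr true x) y = 0.
Hypothesis B_comm : forall x y z, B x (B y z) = B y (B x z).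

Definition twist (x y : V) : V := br x y - B x y + B y x.

Lemma twist_bilin : bilin twist.
Proof.
have [_ [bVr bVl] _ _ _] := LV.
by split=> z a x y; rewrite /twist ?bVl ?bVr !(BL.1 z a x y, BL.2 z a x y); module.
Qed.

Lemma twist_lie_superalgebra : is_lie_superalgebra pr twist.
Proof.
have [HS [bVr bVl] bh bs bj] := LV; have bL : bilin br by split.
have Bo x y : hom pr true x -> B x y = 0 by move=> <-.
have Bh a x y : hom pr a y -> hom pr a (B x y) by rewrite /hom -B_pr => ->.
split=> //.
- by split; case: twist_bilin.
- move=> a b x y xa yb; apply: homD => //; first apply: homD => //.
  + exact: bh.
  + by apply: homN => //; case: a xa => xa; rewrite ?(Bo _ _ xa);
      [exact: hom0|exact: Bh].
  + by case: b yb => yb; rewrite ?(Bo _ _ yb) ?addbF; [exact: hom0|exact: Bh].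
- move=> a b x y xa yb; rewrite /twist (bs a b) //.
  case: a xa => xa; case: b yb => yb; rewrite ?(Bo _ _ xa) ?(Bo _ _ yb) /=;
    by module.
move=> a b x y z xa yb; rewrite /twist.
rewrite !(linD (bVr _)) !(linD (bVl _)) !(linN (bVr _)) !(linN (bVl _)).
rewrite !(linD (BL.1 _)) !(linD (BL.2 _)) !(linN (BL.1 _)) !(linN (BL.2 _)).
rewrite !B_der !B_br !B_B (bj a b) // (B_comm x y) (B_comm z x) (B_comm z y).
(* Skew symmetry matches this term with the one of twist y (twist x z). *)
rewrite (bs a b (B z x) y) ?/hom -?B_pr ?xa //.
case: a xa => xa; case: b yb => yb; rewrite ?(Bo _ _ xa) ?(Bo _ _ yb) /=;
  rewrite ?(lin0 (bVr _), lin0 (bVl _), lin0 (BL.2 _)); by module.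
Qed.

Section Cocycle.
Variable cobr : V -> tens V V.
Hypothesis cobrL : linear cobr.
Let HS : is_superspace pr. Proof. by case: LV. Qed.
Let brL : bilin br. Proof. by case: LV => _ []. Qed.

Definition cocycle_at (br' : V -> V -> V) a b x y : Prop :=
  cobr (br' x y) =
    tact pr br' x (cobr y) - (-1) ^+ (a && b) *: tact pr br' y (cobr x).

Lemma cocycle_at0l a b y : cocycle_at twist a b 0 y.
Proof.
have tL := twist_bilin; rewrite /cocycle_at (lin0 (tL.1 _)) (lin0 cobrL).
by rewrite (lin0 (tact_linl HS tL _)) (lin0 (tactP HS tL _)) scaler0 subrr.
Qed.
Lemma cocycle_at0r a b x : cocycle_at twist a b x 0.
Proof.
have tL := twist_bilin; rewrite /cocycle_at (lin0 (tL.2 _)) (lin0 cobrL).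
by rewrite (lin0 (tact_linl HS tL _)) (lin0 (tactP HS tL _)) scaler0 subrr.
Qed.
Lemma cocycle_atl a b c x x' y : cocycle_at twist a b x y ->
  cocycle_at twist a b x' y -> cocycle_at twist a b (c *: x + x') y.
Proof.
have tL := twist_bilin; rewrite /cocycle_at => E E'.
rewrite tL.1 !cobrL (tact_linl HS tL) (tactP HS tL) E E'.
have shuffle (W : lmodType k) (e : k) (t1 t2 t3 t4 : W) :
    c *: (t1 - e *: t2) + (t3 - e *: t4) =
    c *: t1 + t3 - e *: (c *: t2 + t4) by module.
exact: shuffle.
Qed.
Lemma cocycle_atr a b c x y y' : cocycle_at twist a b x y ->
  cocycle_at twist a b x y' -> cocycle_at twist a b x (c *: y + y').
Proof.
have tL := twist_bilin; rewrite /cocycle_at => E E'.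
rewrite tL.2 !cobrL (tact_linl HS tL) (tactP HS tL) E E'.
have shuffle (W : lmodType k) (e : k) (t1 t2 t3 t4 : W) :
    c *: (t1 - e *: t2) + (t3 - e *: t4) =
    c *: t1 + t3 - e *: (c *: t2 + t4) by module.
exact: shuffle.
Qed.

(** Here [x] is an eigenvector of every [B u], with eigenvalue [q u]: the two terms
    [B u x] and [B v x] created by the twist then contract the tensor with [q]. *)
Lemma tact_twist (q : V -> k^o) a x t : linear q ->
  (forall u, q (pr true u) = 0) -> (forall u, B u x = (q u : k) *: x) ->
  hom pr a x ->
  tact pr twist x t = tact pr br x t - tder (B x) t
    + tensor x (contract q (sflip pr t))
    + tensor (signed pr a (contract q t)) x.
Proof.
move=> qL q_odd Bx xa; have tL := twist_bilin.
have qP := contractP qL; have qT := contractT qL.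
have BxL := BL.2 x.
move: t; apply: (tens_hom_ext HS) => [||b c u v ub vc].
- by refine (tactP HS tL x).
- apply: linear_add; first apply: linear_add; first apply: linear_add.
  + by refine (tactP HS brL x).
  + exact: linear_opp (tderP BxL).
  + exact: linear_comp ((tensor_bilin V V).2 x) (linear_comp qP (sflipP HS)).
  + exact: linear_comp ((tensor_bilin V V).1 x) (linear_comp (signedP HS a) qP).
rewrite (tactT HS tL v xa ub) (tactT HS brL v xa ub) (tderT BxL).
rewrite (sflipT HS ub vc) (linZ qP) !qT (linZ (signedP HS a)).
rewrite (signedE HS a ub) /twist !(tensorDl, tensorDr, tensorNl, tensorNr).
rewrite !Bx !(tensorZl, tensorZr).
(* The sign only matters when B x or q u is zero. *)
have E2 : (-1) ^+ (a && b) *: tensor u (B x v) = tensor u (B x v).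
  case: a xa => xa; last by rewrite scale1r.
  by rewrite -xa B_odd tensor0r scaler0.
have E1 : (-1) ^+ (b && c) *: ((q u : k) *: tensor x v) = (q u : k) *: tensor x v.
  case: b {E2} ub => ub; last by rewrite scale1r.
  by rewrite -ub q_odd scale0r scaler0.
rewrite !(scalerDr, scalerN) E1 E2.
have shuffle (W : lmodType k) (e r r' : k) (t1 t2 t3 t4 t5 t6 : W) :
    t1 - t2 + r *: t3 + (e *: t4 - t5 + e *: (r' *: t6)) =
    t1 + e *: t4 - (t2 + t5) + r *: t3 + r' *: (e *: t6) by module.
exact: shuffle.
Qed.

Hypothesis cobr_flip : forall x, sflip pr (cobr x) = - cobr x.
Hypothesis cobr_B : forall x y, tder (B x) (cobr y) = cobr (B x y).

Lemma tact_twist_cobr (q : V -> k^o) a b x y w : linear q ->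
  (forall u, q (pr true u) = 0) -> (forall u, B u x = (q u : k) *: x) ->
  hom pr a x -> hom pr b y -> contract q (cobr y) = - (w *: y) ->
  tact pr twist x (cobr y) = tact pr br x (cobr y) - cobr (B x y)
    + w *: tensor x y - w *: ((-1) ^+ (a && b) *: tensor y x).
Proof.
move=> qL q_odd Bx xa yb qy; rewrite (tact_twist _ qL q_odd Bx xa).
rewrite cobr_flip (linN (contractP qL)) qy opprK cobr_B.
rewrite (linN (signedP HS a)) (linZ (signedP HS a)) (signedE HS a yb).
by rewrite tensorNl !(tensorZl, tensorZr).
Qed.

(** The extra terms of the actions of [x] and of [y] are proportional to
    [x (x) y - s y (x) x] with [s] the sign of the exchange; as
    [contract q' (cobr x)] and [contract q (cobr y)] carry opposite scalars, they
    cancel. *)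
Lemma twist_cocycle_at (q q' : V -> k^o) a b x y w :
  linear q -> (forall u, q (pr true u) = 0) ->
  (forall u, B u x = (q u : k) *: x) ->
  linear q' -> (forall u, q' (pr true u) = 0) ->
  (forall u, B u y = (q' u : k) *: y) ->
  hom pr a x -> hom pr b y ->
  contract q (cobr y) = - (w *: y) -> contract q' (cobr x) = w *: x ->
  cocycle_at br a b x y -> cocycle_at twist a b x y.
Proof.
move=> qL q_odd Bx qL' q_odd' By xa yb qy qx.
have qx' : contract q' (cobr x) = - ((- w) *: x) by rewrite scaleNr opprK.
rewrite /cocycle_at (tact_twist_cobr qL q_odd Bx xa yb qy).
rewrite (tact_twist_cobr qL' q_odd' By yb xa qx') andbC => E.
rewrite /twist (linD cobrL) (linB cobrL) {}E [b && a]andbC.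
have sD : (-1) ^+ (a && b) *: cobr (B y x) = cobr (B y x).
  case: b yb => yb; last by rewrite andbF scale1r.
  by rewrite -yb B_odd (lin0 cobrL) scaler0.
(* The coefficient of the first tensor on the right is w (1 - s s) = 0. *)
rewrite -{1}sD; set s := (-1) ^+ _.
have s2 : s * s = 1 by rewrite /s -expr2 sqrr_sign.
have shuffle (W : lmodType k) (t1 t2 t3 t4 t5 t6 : W) :
    t1 - s *: t2 - t3 + s *: t4 =
    t1 - t3 + w *: t5 - w *: (s *: t6) -
    s *: (t2 - t4 + - w *: t6 - - w *: (s *: t5)).
  transitivity (t1 - s *: t2 - t3 + s *: t4 + (w * (1 - s * s)) *: t5).
    by rewrite s2 subrr mulr0 scale0r addr0.
  by module.
exact: shuffle.
Qed.
End Cocycle.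
End Twist.

(** * Functoriality *)

Section Natural.
Context (k : fieldType) (V W : lmodType k).
Context (prV : bool -> V -> V) (prW : bool -> W -> W) (f : V -> W).
Hypotheses (SV : is_superspace prV) (SW : is_superspace prW).
Hypotheses (fL : linear f) (fpr : forall a x, f (prV a x) = prW a (f x)).

Lemma map_hom a x : hom prV a x -> hom prW a (f x).
Proof. by rewrite /hom -fpr => ->. Qed.

Local Notation ff := (tmap f f).
Lemma sflip_map t : sflip prW (ff t) = ff (sflip prV t).
Proof.
move: t; apply: (tens_hom_ext SV) => [||a b u v ua vb].
- exact: linear_comp (sflipP SW) (tmapP fL fL).
- exact: linear_comp (tmapP fL fL) (sflipP SV).
rewrite (sflipT SV ua vb) (linZ (tmapP fL fL)) !(tmapT fL fL).
by rewrite (sflipT SW (map_hom ua) (map_hom vb)).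
Qed.

Lemma tpr_map a t : tpr prW a (ff t) = ff (tpr prV a t).
Proof.
move: t; apply: (tens_hom_ext SV) => [||b c u v ub vc].
- exact: linear_comp (tprP SW a) (tmapP fL fL).
- exact: linear_comp (tmapP fL fL) (tprP SV a).
rewrite (tprT SV _ ub vc) (tmapT fL fL).
rewrite (tprT SW _ (map_hom ub) (map_hom vc)).
by case: eqP; rewrite ?(tmapT fL fL) ?(lin0 (tmapP fL fL)).
Qed.

Local Notation fff := (tmap f ff).
Lemma scycle_map t : scycle prW (fff t) = fff (scycle prV t).
Proof.
have ffL := tmapP fL fL; have fffL := tmapP fL ffL.
move: t; apply: (tens3_hom_ext SV) => [||a b c u v w ua vb wc].
- exact: linear_comp (scycleP SW) fffL.
- exact: linear_comp fffL (scycleP SV).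
rewrite (scycleT SV ua vb wc) (linZ fffL) !(tmapT fL ffL) !(tmapT fL fL).
by rewrite (scycleT SW (map_hom ua) (map_hom vb) (map_hom wc)).
Qed.

Context (brV : V -> V -> V) (brW : W -> W -> W).
Hypotheses (bV : bilin brV) (bW : bilin brW).
Hypothesis fbr : forall x y, f (brV x y) = brW (f x) (f y).

Lemma tact_map x t : tact prW brW (f x) (ff t) = ff (tact prV brV x t).
Proof.
have ffL := tmapP fL fL.
elim/(parity_ind SV): x t => [c x y IHx IHy|a x xa] t.
  by rewrite fL !(tact_linl SV, tact_linl SW) // ffL IHx IHy.
move: t; apply: (tens_hom_ext SV) => [||b c u v ub vc].
- exact: linear_comp (tactP SW bW _) ffL.
- exact: linear_comp ffL (tactP SV bV x).
rewrite (tactT SV bV v xa ub) (tmapT fL fL).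
rewrite (tactT SW bW _ (map_hom xa) (map_hom ub)) (linD ffL) (linZ ffL).
by rewrite !(tmapT fL fL) !fbr.
Qed.

End Natural.

Lemma can_linear (k : fieldType) (V W : lmodType k) (f : V -> W) (g : W -> V) :
  linear f -> cancel f g -> cancel g f -> linear g.
Proof. by move=> fL fK gK a x y; rewrite -{1}[x]gK -{1}[y]gK -fL fK. Qed.

Section Transport.
Context (k : fieldType) (V W : lmodType k).
Context (prV : bool -> V -> V) (prW : bool -> W -> W).
Context (brV : V -> V -> V) (brW : W -> W -> W).
Context (cobr : V -> tens V V) (f : W -> V) (g : V -> W).
Hypotheses (HV : is_lie_superbialgebra_for prV brV cobr).
Hypotheses (HW : is_lie_superalgebra prW brW).
Hypotheses (fL : linear f) (fpr : forall a x, f (prW a x) = prV a (f x)).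
Hypothesis fbr : forall x y, f (brW x y) = brV (f x) (f y).
Hypotheses (fK : cancel f g) (gK : cancel g f).

(** Every axiom is an identity between maps of tensor powers that are natural in
    the Lie superalgebra. *)
Lemma transport_superbialgebra :
  is_lie_superbialgebra_for prW brW (fun x => tmap g g (cobr (f x))).
Proof.
case: HV => -[SV [bVr bVl] _ _ _] [[cL cpr] cflip cJ cC].
have bV : bilin brV by split.
have [SW [bWr bWl] _ _ _] := HW; have bW : bilin brW by split.
have gL := can_linear fL fK gK; have ggL := tmapP gL gL.
have gpr a x : g (prV a x) = prW a (g x) by apply: (can_inj fK); rewrite fpr !gK.
have gbr x y : g (brV x y) = brW (g x) (g y).
  by apply: (can_inj fK); rewrite fbr !gK.
split=> //; split.
- split; first exact: linear_comp ggL (linear_comp cL fL).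
  by move=> a x; rewrite fpr cpr (tpr_map SV SW gL gpr).
- by move=> x; rewrite (sflip_map SV SW gL gpr) cflip (linN ggL).
- pose c x := tmap g g (cobr (f x)); have gggL := tmapP gL ggL.
  move=> x; rewrite /= -/(c x).
  change (fun u v : W => _) with (fun u v : W => tensor u (c v)).
  have tV : bilin (fun u v : V => tensor u (cobr v)).
    by split=> [w|u] a v v'; rewrite ?cL (tensorPl, tensorPr).
  have tW : bilin (fun u v : W => tensor u (c v)).
    by split=> [w|u] a v v'; rewrite /c ?fL ?cL ?ggL (tensorPl, tensorPr).
  have -> : tlift (fun u v => tensor u (c v)) (c x) =
      tmap g (tmap g g) (tlift (fun u v => tensor u (cobr v)) (cobr (f x))).
    rewrite /c; move: (cobr (f x)); apply: tens_ext => [||u v].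
    - exact: linear_comp (tliftP tW) ggL.
    - exact: linear_comp gggL (tliftP tV).
    by rewrite (tmapT gL gL) !tliftT // (tmapT gL ggL) /c gK.
  rewrite !(scycle_map SV SW gL gpr) -!(linD gggL).
  by have /= -> := cJ (f x); exact: lin0.
- move=> a b x y xa yb; rewrite fbr (cC _ _ _ _ (map_hom fpr xa) (map_hom fpr yb)).
  rewrite (linB ggL) (linZ ggL) -!(tact_map SV SW gL gpr bV bW gbr).
  by rewrite !fK.
Qed.

End Transport.

Lemma serre_map (k : fieldType) (n : nat) (G : diagram n) (V W : lmodType k)
    (brV : V -> V -> V) (brW : W -> W -> W) (f : V -> W) (X : 'I_n -> V) x :
  linear f -> (forall x y, f (brV x y) = brW (f x) (f y)) ->
  serre G brV X x -> serre G brW (fun i => f (X i)) (f x).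
Proof.
move=> fL fbr; case; intros; rewrite ?(linB fL) ?fbr.
- exact: serre_comm.
- have -> : forall m, f (iter m (brV (X i)) (X j)) = iter m (brW (f (X i))) (f (X j)).
    by elim=> //= m <-.
  exact: (@serre_ad _ _ _ _ _ (fun i => f (X i))).
- exact: (@serre_grey _ _ _ _ _ (fun i => f (X i))).
- exact: (@serre_B2 _ _ _ _ _ (fun i => f (X i))).
- exact: (@serre_D2 _ _ _ _ _ (fun i => f (X i))).
- exact: (@serre_C3 _ _ _ _ _ (fun i => f (X i))).
- exact: (@serre_C4 _ _ _ _ _ (fun i => f (X i))).
Qed.

(** A Serre element is an iterated bracket whose inner terms are generators or
    brackets, so all brackets occurring in it are brackets of elements of [K]. *)
Lemma serre_agree (k : fieldType) (n : nat) (G : diagram n) (V : lmodType k)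
    (br br' : V -> V -> V) (K : V -> Prop) (X : 'I_n -> V) x :
  (forall x y, K x -> K y -> br' x y = br x y) ->
  (forall x y, K (br x y)) -> (forall i, K (X i)) ->
  serre G br' X x -> serre G br X x.
Proof.
move=> agree Kbr KX; case; intros; rewrite ?agree //.
- exact: serre_comm.
- have -> : forall m, iter m (br' (X i)) (X j) = iter m (br (X i)) (X j).
    elim=> //= m ->; rewrite agree //; elim: m => //=.
  exact: serre_ad.
- exact: serre_grey.
- exact: serre_B2.
- exact: serre_D2.
- exact: serre_C3.
- exact: serre_C4.
Qed.

(** A Serre element of a quotient lifts to a Serre element, which is what is needed
    to read the relations in the presented algebra itself. *)
Lemma serre_lift (k : fieldType) (n : nat) (G : diagram n) (V W : lmodType k)
    (brV : V -> V -> V) (brW : W -> W -> W) (f : V -> W) (X : 'I_n -> V) y :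
  linear f -> (forall x y, f (brV x y) = brW (f x) (f y)) ->
  serre G brW (fun i => f (X i)) y -> exists2 x, serre G brV X x & f x = y.
Proof.
move=> fL fbr; case; intros; rewrite -?fbr -?(linB fL).
- by refine (ex_intro2 _ _ _ (serre_comm _ _ _) erefl).
- exists (iter `|1 - cartan G i j|%N (brV (X i)) (X j)); first exact: serre_ad.
  by elim: `|_|%N => //= m <-.
- by refine (ex_intro2 _ _ _ (serre_grey _ _ _) erefl).
- by refine (ex_intro2 _ _ _ (serre_B2 _ _ _ _ _) erefl).
- by refine (ex_intro2 _ _ _ (serre_D2 _ _ _ _ _ _) erefl).
- by refine (ex_intro2 _ _ _ (serre_C3 _ _ _ _ _ _ _ _) erefl).
- by refine (ex_intro2 _ _ _ (serre_C4 _ _ _ _ _ _ _ _ _) erefl).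
Qed.

(** * The presented Lie superalgebra and its universal property *)

Section Presented.
Context (k : fieldType) (n : nat) (G : diagram n) (d : 'I_n -> rat).
Context (R : realization_data k n).
Local Notation h := (rz_h R).
Local Notation gP := (gP G d R).
Local Notation Fr := (Fr R).
Local Notation gbr := (@gbr k n G d R).
Local Notation gpr := (@gpr k n G d R).
Local Notation gH := (@gH k n G d R).
Local Notation gE := (@gE k n G d R).
Local Notation gF := (@gF k n G d R).
Local Notation ideal := (@ideal k n G d R).
Local Notation fbr := (@fbr k n R).

Definition gmono (m : mono h n) : gP := qpi ideal << m >>.

Lemma gbr_bilin : bilin gbr.
Proof. by split; [exact: gbr_linearl|exact: gbr_linearr]. Qed.

Lemma gbr_mono m m' : gbr (gmono m) (gmono m') = gmono (MBr m m').
Proof. by rewrite /gmono gbrE /Defs.fbr !liftU !scale1r. Qed.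

Lemma hom_mono m : hom gpr (mpar G m) (gmono m).
Proof. by rewrite /hom /gmono gprE fprU eqxx. Qed.

Lemma gP_mono_ind (Q : gP -> Prop) :
  Q 0 -> (forall c x y, Q x -> Q y -> Q (c *: x + y)) ->
  (forall m, Q (gmono m)) -> forall x, Q x.
Proof.
move=> Q0 QL Qm; apply: quot_ind; apply: freeg_ind => [|c x y Qx Qy|m].
- by rewrite (lin0 (qpiP _)).
- by rewrite qpiP; exact: QL.
- exact: Qm.
Qed.

Lemma gP_hom_mono_ind (Q : bool -> gP -> Prop) :
  (forall a, Q a 0) ->
  (forall a c x y, Q a x -> Q a y -> Q a (c *: x + y)) ->
  (forall m, Q (mpar G m) (gmono m)) ->
  forall a x, hom gpr a x -> Q a x.
Proof.
move=> Q0 QL Qm a x <-; elim/gP_mono_ind: x => [|c x y xE yE|m].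
- by rewrite (lin0 (prP (gpr_superspace G d R) a)).
- by rewrite (prP (gpr_superspace G d R) a); exact: QL.
rewrite (homE (gpr_superspace G d R) _ (hom_mono m)).
by case: eqP => [->|_].
Qed.

Lemma gP_gen_ind (Q : gP -> Prop) :
  Q 0 -> (forall c x y, Q x -> Q y -> Q (c *: x + y)) ->
  (forall T, Q (gH T)) -> (forall i, Q (gE i)) ->
  (forall i, Q (gF i)) ->
  (forall m m', Q (gmono m) -> Q (gmono m') -> Q (gbr (gmono m) (gmono m'))) ->
  forall x, Q x.
Proof.
move=> Q0 QL QH QE QF QB; apply: gP_mono_ind => // m.
by elim: m => // m Qm m' Qm'; rewrite -gbr_mono; exact: QB.
Qed.

Lemma gP_mono_ext (W : lmodType k) (f g : gP -> W) : linear f -> linear g ->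
  (forall m, f (gmono m) = g (gmono m)) -> f =1 g.
Proof.
move=> fL gL fg; elim/gP_mono_ind => [|c x y xE yE|//].
  by rewrite (lin0 fL) (lin0 gL).
by rewrite fL gL xE yE.
Qed.

Lemma ideal0 x : relator G d x -> qpi ideal x = 0.
Proof.
move=> xR; rewrite -(lin0 (qpiP ideal)); apply: ideal_qpi.
by rewrite subr0; exact: ideal_rel.
Qed.

Lemma gH_linear : linear gH.
Proof.
move=> a T T'; rewrite /Defs.gH -qpiP; apply: ideal_qpi.
exact/ideal_rel/rel_lin.
Qed.
Lemma hom_gH T : hom gpr false (gH T). Proof. exact: hom_mono (MH T). Qed.
Lemma hom_gE i : hom gpr (parity G i) (gE i). Proof. exact: hom_mono (ME i). Qed.
Lemma hom_gF i : hom gpr (parity G i) (gF i). Proof. exact: hom_mono (MF i). Qed.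
Lemma gHH T T' : gbr (gH T) (gH T') = 0.
Proof. by rewrite gbrE; apply: ideal0; exact: rel_HH. Qed.
Lemma gHE T j : gbr (gH T) (gE j) = (rz_alpha R j T : k) *: gE j.
Proof.
rewrite gbrE /Defs.gE -(linZ (qpiP _)); apply: ideal_qpi.
exact/ideal_rel/rel_HE.
Qed.
Lemma gHF T j : gbr (gH T) (gF j) = - ((rz_alpha R j T : k) *: gF j).
Proof.
rewrite gbrE /Defs.gF -(linZ (qpiP _)) -(linN (qpiP _)); apply: ideal_qpi.
by rewrite opprK; apply/ideal_rel/rel_HF.
Qed.
Lemma gEF i l : gbr (gE i) (gF l) =
  if i == l then gH ((ratr (2 * d i))^-1 *: (Tp R i + Tm R i)) else 0.
Proof.
rewrite gbrE (ideal_qpi (ideal_rel (@rel_EF k n G d R i l))).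
by case: eqP; rewrite ?(lin0 (qpiP _)).
Qed.
Lemma qpi_br x y : qpi ideal (fbr x y) = gbr (qpi ideal x) (qpi ideal y).
Proof. by rewrite gbrE. Qed.
Lemma gserre_E x : serre G gbr gE x -> x = 0.
Proof.
move=> xS; have [y yS <-] := serre_lift (qpiP ideal) qpi_br xS.
by apply: ideal0; exact: rel_EE.
Qed.
Lemma gserre_F x : serre G gbr gF x -> x = 0.
Proof.
move=> xS; have [y yS <-] := serre_lift (qpiP ideal) qpi_br xS.
by apply: ideal0; exact: rel_FF.
Qed.

Section Universal.
Context (V : lmodType k) (pr : bool -> V -> V) (br : V -> V -> V).
Context (H : h -> V) (E F : 'I_n -> V).

Record satisfies_relations : Prop := SatisfiesRelations {
  sr_H : linear H;
  sr_homH : forall T, hom pr false (H T);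
  sr_homE : forall i, hom pr (parity G i) (E i);
  sr_homF : forall i, hom pr (parity G i) (F i);
  sr_HH : forall T T', br (H T) (H T') = 0;
  sr_HE : forall T j, br (H T) (E j) = (rz_alpha R j T : k) *: E j;
  sr_HF : forall T j, br (H T) (F j) = - ((rz_alpha R j T : k) *: F j);
  sr_EF : forall i l, br (E i) (F l) =
    if i == l then H ((ratr (2 * d i))^-1 *: (Tp R i + Tm R i)) else 0;
  sr_EE : forall x, serre G br E x -> x = 0;
  sr_FF : forall x, serre G br F x -> x = 0 }.

Hypothesis LV : is_lie_superalgebra pr br.
Hypothesis SR : satisfies_relations.

Fixpoint eval_mono (m : mono h n) : V :=
  match m with
  | MH T => H T
  | ME i => E i
  | MF i => F i
  | MBr m1 m2 => br (eval_mono m1) (eval_mono m2)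
  end.

Definition eval_free : Fr -> V := fglift eval_mono.
Definition eval_gP : gP -> V := qlift eval_free.

Lemma eval_freeP : linear eval_free. Proof. exact: linearP. Qed.
Lemma eval_freeU m : eval_free << m >> = eval_mono m.
Proof. by rewrite /eval_free liftU scale1r. Qed.

Lemma eval_free_br x y : eval_free (fbr x y) = br (eval_free x) (eval_free y).
Proof.
have [_ [bVr bVl] _ _ _] := LV; move: x y.
elim/freeg_ind=> [y|c u v IHu IHv y|m].
- by rewrite fbr0l (lin0 eval_freeP) (lin0 (bVl _)).
- by rewrite fbr_linearl !eval_freeP IHu IHv bVl.
elim/freeg_ind=> [|c u v IHu IHv|m'].
- by rewrite fbr0r (lin0 eval_freeP) (lin0 (bVr _)).
- by rewrite fbr_linearr !eval_freeP IHu IHv bVr.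
by rewrite /Defs.fbr !liftU !scale1r !eval_freeU.
Qed.

Lemma hom_eval_mono m : hom pr (mpar G m) (eval_mono m).
Proof.
have [_ _ bh _ _] := LV; have [_ HH HE HF _ _ _ _ _ _] := SR.
by elim: m => //= m1 IH1 m2 IH2; exact: bh.
Qed.

Lemma eval_relator x : relator G d x -> eval_free x = 0.
Proof.
have [_ [bVr bVl] _ bsym bjac] := LV; have fL := eval_freeP.
case.
- move=> m m'; rewrite (linD fL) (linZ fL) !eval_freeU /=.
  by rewrite (bsym _ _ _ _ (hom_eval_mono m) (hom_eval_mono m')) addNr.
- move=> m1 m2 m3; rewrite (linB fL) (linD fL) (linZ fL) !eval_freeU /=.
  by rewrite (bjac _ _ _ _ _ (hom_eval_mono m1) (hom_eval_mono m2)) subrr.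
- move=> a T T'; rewrite (linB fL) (linD fL) (linZ fL) !eval_freeU /=.
  by rewrite (sr_H SR) subrr.
- by move=> T T'; rewrite eval_free_br !eval_freeU /= (sr_HH SR).
- move=> T j; rewrite (linB fL) eval_free_br (linZ fL) !eval_freeU /=.
  by rewrite (sr_HE SR) subrr.
- move=> T j; rewrite (linD fL) eval_free_br (linZ fL) !eval_freeU /=.
  by rewrite (sr_HF SR) addNr.
- move=> i l; rewrite (linB fL) eval_free_br !eval_freeU /= (sr_EF SR).
  by case: eqP => _; rewrite ?(lin0 fL) ?eval_freeU subrr.
- move=> y /(serre_map fL eval_free_br) yS; apply: (sr_EE SR).
  by rewrite (_ : E = fun i => eval_free (fE R i)) //; apply/funext => i;
    rewrite eval_freeU.
- move=> y /(serre_map fL eval_free_br) yS; apply: (sr_FF SR).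
  by rewrite (_ : F = fun i => eval_free (fF R i)) //; apply/funext => i;
    rewrite eval_freeU.
Qed.

Lemma eval_ideal x : ideal x -> eval_free x = 0.
Proof.
have [_ [bVr bVl] _ _ _] := LV; have fL := eval_freeP.
elim=> {x} [x|| x y _ xE _ yE|a x _ xE|x y _ xE|x y _ yE].
- exact: eval_relator.
- exact: lin0.
- by rewrite (linD fL) xE yE addr0.
- by rewrite (linZ fL) xE scaler0.
- by rewrite eval_free_br xE (lin0 (bVl _)).
- by rewrite eval_free_br yE (lin0 (bVr _)).
Qed.

Lemma eval_qpi x : eval_gP (qpi ideal x) = eval_free x.
Proof. exact: qliftE eval_ideal. Qed.

Lemma eval_gPP : linear eval_gP.
Proof.
move=> a; apply: quot_ind => x; apply: quot_ind => y.
by rewrite -qpiP !eval_qpi eval_freeP.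
Qed.
Lemma eval_gbr x y : eval_gP (gbr x y) = br (eval_gP x) (eval_gP y).
Proof.
by elim/quot_ind: x => x; elim/quot_ind: y => y; rewrite gbrE !eval_qpi eval_free_br.
Qed.
Lemma eval_gmono m : eval_gP (gmono m) = eval_mono m.
Proof. by rewrite eval_qpi eval_freeU. Qed.
Lemma eval_gH T : eval_gP (gH T) = H T. Proof. exact: eval_gmono (MH T). Qed.
Lemma eval_gE i : eval_gP (gE i) = E i. Proof. exact: eval_gmono (ME i). Qed.
Lemma eval_gF i : eval_gP (gF i) = F i. Proof. exact: eval_gmono (MF i). Qed.
Lemma eval_gpr a x : eval_gP (gpr a x) = pr a (eval_gP x).
Proof.
have [SV _ _ _ _] := LV; move: x; apply: gP_mono_ext => [||m].
- exact: linear_comp eval_gPP (prP (@gpr_superspace _ _ _ _ _) a).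
- exact: linear_comp (prP SV a) eval_gPP.
rewrite (homE (@gpr_superspace _ _ _ _ _) _ (hom_mono m)) eval_gmono.
rewrite (homE SV _ (hom_eval_mono m)).
by case: eqP => _; rewrite ?eval_gmono ?(lin0 eval_gPP).
Qed.
End Universal.
End Presented.

(** * Degree derivations and characters *)

Section Weights.
Context (k : fieldType) (n : nat) (G : diagram n) (d : 'I_n -> rat).
Context (R : realization_data k n).
Local Notation h := (rz_h R).
Local Notation gP := (gP G d R).
Local Notation Fr := (Fr R).
Local Notation gbr := (@gbr k n G d R).
Local Notation gpr := (@gpr k n G d R).
Local Notation gH := (@gH k n G d R).
Local Notation gE := (@gE k n G d R).
Local Notation gF := (@gF k n G d R).
Local Notation ideal := (@ideal k n G d R).
Local Notation fbr := (@fbr k n R).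
Local Notation gmono := (@gmono k n G d R).

(** The value of the linear form [c] on the degree of [m] in the root lattice,
    where [E_i] has degree the [i]-th basis vector and [F_i] its opposite.  This
    grading cannot be read off the action of [h], because the roots in [h^*] need
    not be linearly independent. *)
Fixpoint weight (c : 'I_n -> k) (m : mono h n) : k :=
  match m with
  | MH _ => 0
  | ME i => c i
  | MF i => - c i
  | MBr x y => weight c x + weight c y
  end.

Lemma weight_linear a c c' m :
  weight (fun i => a * c i + c' i) m = a * weight c m + weight c' m.
Proof. by elim: m => //= [T|i|m1 -> m2 ->]; ring. Qed.
Lemma weight0 m : weight (fun=> 0) m = 0.
Proof. by elim: m => //= [i|m1 -> m2 ->]; rewrite ?oppr0 ?addr0. Qed.
Lemma weightN c m : weight (fun i => - c i) m = - weight c m.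
Proof. by elim: m => //= [T|m1 -> m2 ->]; ring. Qed.
(** A bilinear form on the root lattice, evaluated in either order. *)
Lemma weight_swap (M : 'I_n -> 'I_n -> k) m m' :
  weight (fun i => weight (M i) m') m = weight (fun j => weight (M^~ j) m) m'.
Proof.
elim: m => [T|i|i|m1 IH1 m2 IH2] /=; rewrite ?weight0 ?weightN //.
by rewrite IH1 IH2; elim: m' {IH1 IH2} => //= [T|j|m1' <- m2' <-]; ring.
Qed.

Section Degree.
Variable c : 'I_n -> k.

Definition fdeg : Fr -> Fr := fglift (fun m => weight c m *: << m >> : Fr).
Lemma fdegP : linear fdeg. Proof. exact: linearP. Qed.
Lemma fdegU m : fdeg << m >> = weight c m *: << m >>.
Proof. by rewrite /fdeg liftU scale1r. Qed.

Lemma fbr_mono m m' : fbr << m >> << m' >> = << MBr m m' >>.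
Proof. by rewrite /Defs.fbr !liftU !scale1r. Qed.

Lemma fdeg_br x y : fdeg (fbr x y) = fbr (fdeg x) y + fbr x (fdeg y).
Proof.
move: x y; elim/freeg_ind=> [y|e u v IHu IHv y|m].
- by rewrite (lin0 fdegP) !fbr0l (lin0 fdegP) addr0.
- by rewrite fdegP !fbr_linearl fdegP IHu IHv; module.
elim/freeg_ind=> [|e u v IHu IHv|m'].
- by rewrite (lin0 fdegP) !fbr0r (lin0 fdegP) addr0.
- by rewrite fdegP !fbr_linearr fdegP IHu IHv; module.
rewrite !fdegU (linZ (fbr_linearl _)) (linZ (fbr_linearr _)) !fbr_mono fdegU.
exact: scalerDl.
Qed.

Definition feigen (a : k) (x : Fr) := fdeg x = a *: x.
Lemma feigen_br a b x y : feigen a x -> feigen b y -> feigen (a + b) (fbr x y).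
Proof.
rewrite /feigen => xa yb; rewrite fdeg_br xa yb.
by rewrite (linZ (fbr_linearl _)) (linZ (fbr_linearr _)) scalerDl.
Qed.
Lemma feigenU m : feigen (weight c m) << m >>. Proof. exact: fdegU. Qed.
Lemma feigenP a e x y : feigen a x -> feigen a y -> feigen a (e *: x + y).
Proof. by rewrite /feigen fdegP => -> ->; module. Qed.
Lemma feigenD a x y : feigen a x -> feigen a y -> feigen a (x + y).
Proof. by move=> xa; rewrite -[x]scale1r; exact: feigenP. Qed.
Lemma feigenN a x : feigen a x -> feigen a (- x).
Proof. by rewrite /feigen (linN fdegP) scalerN => ->. Qed.
Lemma feigenZ a e x : feigen a x -> feigen a (e *: x).
Proof. by rewrite /feigen (linZ fdegP) => ->; module. Qed.
Lemma feigen0 a : feigen a 0.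
Proof. by rewrite /feigen (lin0 fdegP) scaler0. Qed.

Lemma serre_feigen (w : 'I_n -> k) (X : 'I_n -> Fr) x :
  (forall i, feigen (w i) (X i)) -> serre G fbr X x -> exists a, feigen a x.
Proof.
move=> Xw; case=> [i j _|i j _ _|i j l _|i j _ _ _|i j l _ _ _ _|
    i j l _ _ _ _ _ _|g i j l _ _ _ _ _ _ _];
  try by eexists; do ?[exact: Xw | apply: feigen_br].
- elim: `|_|%N => [|m [a IH]] /=; first by eexists; exact: Xw.
  by eexists; apply: feigen_br (Xw i) IH.
- exists (w i + w j + w l); apply: feigenD.
    by do ?[exact: Xw | apply: feigen_br].
  by rewrite addrAC; apply: feigenN; do ?[exact: Xw | apply: feigen_br].
Qed.

(** The defining relations are homogeneous for the root lattice grading, so that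
    the degree derivation descends to the presented algebra. *)
Lemma relator_feigen x : relator G d x -> exists a, feigen a x.
Proof.
have HE i : feigen (c i) (fE R i) by exact: feigenU (ME i).
have HF i : feigen (- c i) (fF R i) by exact: feigenU (MF i).
have HH T : feigen 0 (fH T) by exact: feigenU (MH T).
case=> [m m'|m1 m2 m3|a T T'|T T'|T j|T j|i l|y|y].
- eexists; apply: feigenD; first exact: feigenU.
  by rewrite /= addrC; apply: feigenZ; exact: feigenU (MBr m' m).
- eexists; apply: feigenD; first exact: feigenU.
  apply: feigenN; apply: feigenD.
    by rewrite /= addrA; exact: feigenU (MBr (MBr m1 m2) m3).
  by rewrite /= addrCA; apply: feigenZ; exact: feigenU (MBr m2 (MBr m1 m3)).
- by exists 0; apply: feigenD (HH _) _; apply: feigenN; exact: feigenP.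
- by eexists; apply: feigen_br (HH T) (HH T').
- eexists; apply: feigenD; first exact: feigen_br (HH T) (HE j).
  by rewrite add0r; apply/feigenN/feigenZ/HE.
- eexists; apply: feigenD; first exact: feigen_br (HH T) (HF j).
  by rewrite add0r; apply/feigenZ/HF.
- eexists; apply: feigenD; first exact: feigen_br (HE i) (HF l).
  apply: feigenN; case: eqP => [->|_]; last exact: feigen0.
  by rewrite subrr; exact: HH.
- exact: serre_feigen HE.
- exact: serre_feigen HF.
Qed.

Lemma ideal_fdeg x : ideal x -> ideal (fdeg x).
Proof.
elim=> {x} [x xR|| x y _ xI _ yI|a x _ xI|x y xI xI'|x y yI yI'].
- have [a ->] := relator_feigen xR; exact/ideal_scale/ideal_rel.
- by rewrite (lin0 fdegP); exact: ideal_zero.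
- by rewrite (linD fdegP); exact: ideal_add.
- by rewrite (linZ fdegP); exact: ideal_scale.
- by rewrite fdeg_br; apply: ideal_add; exact: ideal_brl.
- by rewrite fdeg_br; apply: ideal_add; exact: ideal_brr.
Qed.

Definition wdeg : gP -> gP := qlift (fun x => qpi ideal (fdeg x)).

Lemma wdeg_qpi x : wdeg (qpi ideal x) = qpi ideal (fdeg x).
Proof.
rewrite /wdeg /qlift; apply: ideal_qpi; rewrite -(linB fdegP).
exact/ideal_fdeg/ideal_repr.
Qed.
Lemma wdegP : linear wdeg.
Proof.
move=> a; apply: quot_ind => x; apply: quot_ind => y.
by rewrite -qpiP !wdeg_qpi fdegP qpiP.
Qed.
Lemma wdeg_mono m : wdeg (gmono m) = weight c m *: gmono m.
Proof. by rewrite wdeg_qpi fdegU (linZ (qpiP _)). Qed.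
Lemma wdeg_br x y : wdeg (gbr x y) = gbr (wdeg x) y + gbr x (wdeg y).
Proof.
elim/quot_ind: x => x; elim/quot_ind: y => y.
by rewrite gbrE !wdeg_qpi fdeg_br (linD (qpiP _)) !qpi_br.
Qed.
Lemma wdeg_gpr a x : wdeg (gpr a x) = gpr a (wdeg x).
Proof.
have prL a := prP (@gpr_superspace k n G d R) a; move: x.
apply: gP_mono_ext => [||m].
- exact: linear_comp wdegP (prL a).
- exact: linear_comp (prL a) wdegP.
rewrite wdeg_mono (linZ (prL a)).
rewrite (homE (@gpr_superspace k n G d R) _ (hom_mono G d m)).
by case: eqP; rewrite ?wdeg_mono ?(lin0 wdegP) ?scaler0.
Qed.
Lemma wdeg_gH T : wdeg (gH T) = 0.
Proof. by rewrite (wdeg_mono (MH T)) scale0r. Qed.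
Lemma wdeg_gE i : wdeg (gE i) = c i *: gE i.
Proof. exact: (wdeg_mono (ME i)). Qed.
Lemma wdeg_gF i : wdeg (gF i) = - c i *: gF i.
Proof. exact: (wdeg_mono (MF i)). Qed.
End Degree.

Lemma wdeg_linear a c c' x :
  wdeg (fun i => a * c i + c' i) x = a *: wdeg c x + wdeg c' x.
Proof.
elim/gP_mono_ind: x => [|e x y IHx IHy|m].
- by rewrite !(lin0 (wdegP _)) scaler0 addr0.
- by rewrite !wdegP IHx IHy; module.
by rewrite !wdeg_mono weight_linear; module.
Qed.
Lemma wdeg0 x : wdeg (fun=> 0) x = 0.
Proof.
have := wdeg_linear (-1) (fun=> 0) (fun=> 0) x; rewrite scaleN1r addNr => <-.
by congr (wdeg _ x); apply/funext => i; ring.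
Qed.

(** The one-dimensional abelian Lie algebra, with [lam] on [h] and zero for the
    other generators, satisfies the defining relations: only the brackets
    [[E_i, F_i]] constrain [lam]. *)
Section Character.
Variable lam : h -> k^o.
Hypothesis lamL : linear lam.
Hypothesis lamS : forall i, lam (Tp R i + Tm R i) = 0.

Definition ko_pr (a : bool) (x : k^o) : k^o := if a then 0 else x.
Definition ko_br (x y : k^o) : k^o := 0.

Lemma ko_lie : is_lie_superalgebra ko_pr ko_br.
Proof.
have ko0 : linear (fun _ : k^o => 0 : k^o) by move=> a x y; rewrite scaler0 addr0.
split=> //.
- split=> [[] a x y|[] [] x|x] //=; first by rewrite scaler0 addr0.
  by rewrite /= addr0.
- by move=> [] [] x y; rewrite /hom /ko_pr /ko_br.
- by move=> a b x y _ _; rewrite /ko_br scaler0 oppr0.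
- by move=> a b x y z _ _; rewrite /ko_br scaler0 addr0.
Qed.

Lemma ko_relations :
  satisfies_relations G d (R := R) ko_pr ko_br lam (fun=> 0) (fun=> 0).
Proof.
have S0 x : serre G ko_br (fun=> 0 : k^o) x -> x = 0.
  case=> [||||i j l _ _ _ _||] //; last by rewrite /ko_br subrr.
  by move=> i j _ _; case: `|_|%N.
split=> //; rewrite ?/hom //=.
- by move=> i; case: (parity G i).
- by move=> i; case: (parity G i).
- by move=> T j; rewrite scaler0.
- by move=> T j; rewrite scaler0 oppr0.
by move=> i l; rewrite (linZ lamL) lamS scaler0 if_same.
Qed.

Definition toral_char : gP -> k^o :=
  eval_gP (G := G) (d := d) ko_br lam (fun=> 0) (fun=> 0).
Lemma toral_charP : linear toral_char. Proof. exact: eval_gPP ko_lie ko_relations. Qed.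
Lemma toral_char_br x y : toral_char (gbr x y) = 0.
Proof. exact: (eval_gbr ko_lie ko_relations). Qed.
Lemma toral_char_gH T : toral_char (gH T) = lam T.
Proof. exact: (eval_gH ko_lie ko_relations). Qed.
Lemma toral_char_gE i : toral_char (gE i) = 0.
Proof. exact: (eval_gE ko_lie ko_relations). Qed.
Lemma toral_char_gF i : toral_char (gF i) = 0.
Proof. exact: (eval_gF ko_lie ko_relations). Qed.
Lemma toral_char_odd x : toral_char (gpr true x) = 0.
Proof. exact: (eval_gpr ko_lie ko_relations). Qed.
Lemma toral_char_even x : toral_char (gpr false x) = toral_char x.
Proof. exact: (eval_gpr ko_lie ko_relations). Qed.
Lemma toral_char_wdeg c x : toral_char (wdeg c x) = 0.
Proof.
elim/gP_gen_ind: x => [|e x y IHx IHy|T|i|i|m m' _ _].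
- by rewrite (lin0 (wdegP _)) (lin0 toral_charP).
- by rewrite wdegP toral_charP IHx IHy scaler0 addr0.
- by rewrite wdeg_gH (lin0 toral_charP).
- by rewrite wdeg_gE (linZ toral_charP) toral_char_gE scaler0.
- by rewrite wdeg_gF (linZ toral_charP) toral_char_gF scaler0.
by rewrite wdeg_br (linD toral_charP) !toral_char_br addr0.
Qed.
End Character.

Section Cobracket.
Variable g : mplsba G d R.
Local Notation cobr := (mp_cobr g).
Let HS := @gpr_superspace k n G d R.
Let brL := @gbr_bilin k n G d R.

Lemma cobrP : linear cobr.
Proof. by case: (mp_lie_superbialgebra g) => _ [[]]. Qed.
Lemma cobr_flip x : sflip gpr (cobr x) = - cobr x.
Proof. by case: (mp_lie_superbialgebra g) => _ [_ /(_ x)]. Qed.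
Lemma cobr_mono m m' : cobr (gbr (gmono m) (gmono m')) =
  tact gpr gbr (gmono m) (cobr (gmono m')) -
  (-1) ^+ (mpar G m && mpar G m') *: tact gpr gbr (gmono m') (cobr (gmono m)).
Proof.
have [_ [_ _ _ cC]] := mp_lie_superbialgebra g.
exact: cC (hom_mono G d m) (hom_mono G d m').
Qed.
Lemma gbr_skew m m' : gbr (gmono m) (gmono m') =
  - ((-1) ^+ (mpar G m && mpar G m') *: gbr (gmono m') (gmono m)).
Proof.
have [_ _ _ bs _] := @gP_lie_superalgebra k n G d R.
exact: bs (hom_mono G d m) (hom_mono G d m').
Qed.

Hypothesis two0 : 2 != 0 :> k.

Lemma cobrE i : cobr (gE i) =
  tensor (gH (Tp R i)) (gE i) - tensor (gE i) (gH (Tp R i)).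
Proof.
rewrite mp_cobrE /wedge scalerA divff // scale1r.
by rewrite (sflipT HS (hom_gH _ _ _) (hom_gE _ _ _ _)) /= expr0 scale1r.
Qed.
Lemma cobrF i : cobr (gF i) =
  tensor (gH (Tm R i)) (gF i) - tensor (gF i) (gH (Tm R i)).
Proof.
rewrite mp_cobrF /wedge scalerA divff // scale1r.
by rewrite (sflipT HS (hom_gH _ _ _) (hom_gF _ _ _ _)) /= expr0 scale1r.
Qed.

(** Both sides are derivations, by [contract_tact] and the cocycle condition; on a
    generator [X] the cobracket is [T (x) X - X (x) T]. *)
Lemma contract_cobr (lam : h -> k^o) x : linear lam ->
  (forall i, lam (Tp R i + Tm R i) = 0) ->
  contract (toral_char lam) (cobr x) = - wdeg (fun i => lam (Tp R i)) x.
Proof.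
move=> lamL lamS; have qL := toral_charP lamL lamS.
have cL := contractP qL.
have ctact := contract_tact HS brL qL (toral_char_br lamL lamS).
have lamN i : lam (Tm R i) = - lam (Tp R i).
  by apply/eqP; rewrite -addr_eq0 addrC -(linD lamL) lamS.
elim/gP_mono_ind: x => [|e x y IHx IHy|m].
- by rewrite (lin0 cobrP) (lin0 cL) (lin0 (wdegP _)) oppr0.
- by rewrite cobrP cL IHx IHy wdegP; module.
elim: m => [T|i|i|m IHm m' IHm'].
- by rewrite mp_cobrH (lin0 cL) wdeg_gH oppr0.
- rewrite cobrE (contract_wedge qL) ?(toral_char_gE lamL lamS) //.
  by rewrite (toral_char_gH lamL lamS) wdeg_gE.
- rewrite cobrF (contract_wedge qL) ?(toral_char_gF lamL lamS) //.
  by rewrite (toral_char_gH lamL lamS) wdeg_gF lamN.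
rewrite -gbr_mono cobr_mono (linB cL) (linZ cL) !ctact.
rewrite IHm IHm' wdeg_br !(linN (brL.2 _)) !wdeg_mono.
rewrite !(linZ (brL.2 _)) !(linZ (brL.1 _)) (gbr_skew m m').
by module.
Qed.

Lemma tder_cobr c x : tder (wdeg c) (cobr x) = cobr (wdeg c x).
Proof.
have DL := wdegP c; have tL := tderP DL.
elim/gP_mono_ind: x => [|e x y IHx IHy|m].
- by rewrite (lin0 DL) (lin0 cobrP) (lin0 tL).
- by rewrite DL !cobrP tL IHx IHy.
rewrite wdeg_mono (linZ cobrP); elim: m => [T|i|i|m IHm m' IHm'].
- by rewrite mp_cobrH (lin0 tL) scaler0.
- by rewrite cobrE (tder_wedge DL (wdeg_gH c _) (wdeg_gE c i)).
- by rewrite cobrF (tder_wedge DL (wdeg_gH c _) (wdeg_gF c i)).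
rewrite -gbr_mono cobr_mono.
exact: (tder_cocycle HS brL DL (wdeg_gpr c) (wdeg_br c) _
  (wdeg_mono c m) (wdeg_mono c m') IHm IHm').
Qed.
End Cobracket.
End Weights.

(** * The twist attached to a toral form *)

Section ToralTwist.
Context (k : fieldType) (n : nat) (G : diagram n) (d : 'I_n -> rat).
Context (R : realization_data k n) (chi : {biscalar (rz_h R)}).
Hypothesis chiS : AltS chi.
Hypothesis two0 : 2 != 0 :> k.
Local Notation h := (rz_h R).
Local Notation gP := (gP G d R).
Local Notation gbr := (@gbr k n G d R).
Local Notation gpr := (@gpr k n G d R).
Local Notation gH := (@gH k n G d R).
Local Notation gE := (@gE k n G d R).
Local Notation gF := (@gF k n G d R).
Local Notation gmono := (@gmono k n G d R).
Let HS := @gpr_superspace k n G d R.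
Let brL := @gbr_bilin k n G d R.

Lemma chi_linr T : linear (chi T : h -> k^o).
Proof. by move=> a x y; rewrite linearPr. Qed.
Lemma chi_linl T : linear (chi^~ T : h -> k^o).
Proof. by move=> a x y; rewrite linearPl. Qed.
Lemma chi_alt x y : chi x y = - chi y x. Proof. by case: chiS. Qed.
Lemma Tpm i : Tp R i + Tm R i = 2 *: Ts R i.
Proof. by rewrite /Ts scalerA divff // scale1r. Qed.
Lemma chi_Sr T i : chi T (Tp R i + Tm R i) = 0.
Proof.
by rewrite Tpm (linZ (chi_linr T)) (chiS.2 i T).2 scaler0.
Qed.
Lemma chi_Sl T i : chi (Tp R i + Tm R i) T = 0.
Proof. by rewrite chi_alt chi_Sr oppr0. Qed.

Definition toral_coord (x : gP) (i : 'I_n) : k :=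
  toral_char (chi (Tp R i) : h -> k^o) x.
Definition toral_act (x : gP) : gP -> gP := wdeg (toral_coord x).
Definition toral_twist : gP -> gP -> gP := twist gbr toral_act.

Let crP i := toral_charP (G := G) (d := d) (chi_linr (Tp R i)) (chi_Sr (Tp R i)).

Lemma toral_actT a x y z :
  toral_act (a *: x + y) z = a *: toral_act x z + toral_act y z.
Proof.
rewrite /toral_act -wdeg_linear; congr (wdeg _ z); apply/funext => i.
exact: crP.
Qed.
Lemma toral_act_bilin : bilin toral_act.
Proof. by split=> [z a x y|x]; [exact: toral_actT|exact: wdegP]. Qed.

Lemma wdeg_zero c (x : gP) : (forall i, c i = 0) -> wdeg c x = 0.
Proof.
by move=> c0; rewrite (_ : c = fun=> 0) ?wdeg0 //; apply/funext.
Qed.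
Lemma toral_coord_br x y i : toral_coord (gbr x y) i = 0.
Proof. by rewrite /toral_coord (toral_char_br (chi_linr _) (chi_Sr _)). Qed.
Lemma toral_coord_wdeg c x i : toral_coord (wdeg c x) i = 0.
Proof. exact: toral_char_wdeg (chi_linr _) (chi_Sr _) _ _. Qed.

Lemma wdeg_comm c c' (x : gP) : wdeg c (wdeg c' x) = wdeg c' (wdeg c x).
Proof.
elim/gP_mono_ind: x => [|e x y IHx IHy|m].
- by rewrite !(lin0 (wdegP _)).
- by rewrite !wdegP IHx IHy.
by rewrite !wdeg_mono !(linZ (wdegP _)) !wdeg_mono !scalerA mulrC.
Qed.

Lemma toral_act_odd x y : toral_act (gpr true x) y = 0.
Proof.
by apply: wdeg_zero => i; rewrite /toral_coord (toral_char_odd (chi_linr _) (chi_Sr _)).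
Qed.

Lemma toral_twist_lie : is_lie_superalgebra gpr toral_twist.
Proof.
apply: twist_lie_superalgebra => [|||||||x y z].
- exact: gP_lie_superalgebra.
- exact: toral_act_bilin.
- by move=> a x y; exact: wdeg_gpr.
- by move=> x y z; exact: wdeg_br.
- by move=> x y z; apply: wdeg_zero => i; exact: toral_coord_br.
- by move=> x y z; apply: wdeg_zero => i; exact: toral_coord_wdeg.
- exact: toral_act_odd.
- exact: wdeg_comm.
Qed.

Section Cobracket.
Variable g : mplsba G d R.
Local Notation cobr := (mp_cobr g).

(** The value of [chi] on [T_mu], [T_nu] for the degrees [mu], [nu] of the two
    monomials. *)
Definition pairing (m m' : mono h n) : k :=
  weight (fun j => weight (fun i => chi (Tp R i) (Tp R j)) m) m'.
Lemma pairing_skew m m' : pairing m m' = - pairing m' m.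
Proof.
rewrite /pairing weight_swap -weightN; congr (weight _ m); apply/funext => i.
by rewrite -weightN; congr (weight _ m'); apply/funext => j; exact: chi_alt.
Qed.

Definition mono_form (m : mono h n) : h -> k^o :=
  fun T => weight (fun i => chi (Tp R i) T) m.
Lemma mono_formP m : linear (mono_form m).
Proof.
move=> a x y; transitivity
  (weight (fun i => a * chi (Tp R i) x + chi (Tp R i) y) m);
  last by rewrite weight_linear.
congr (weight _ m).
by apply/funext => i; exact: chi_linr.
Qed.
Lemma mono_formS m i : mono_form m (Tp R i + Tm R i) = 0.
Proof.
rewrite /mono_form -[RHS](weight0 m); congr (weight _ m); apply/funext => j.
exact: chi_Sr.
Qed.

(** A monomial of degree [mu] is an eigenvector of all the derivations
    [toral_act x], and the eigenvalue is the character [chi(T_mu, -)] at [x]. *)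
Lemma toral_act_mono x m :
  toral_act x (gmono m) = (toral_char (mono_form m) x : k) *: gmono m.
Proof.
rewrite /toral_act wdeg_mono; congr (_ *: _).
have cP := toral_charP (G := G) (d := d) (@mono_formP m) (@mono_formS m).
elim/gP_mono_ind: x => [|e x y IHx IHy|m'].
- rewrite (lin0 cP) -[RHS](weight0 m); congr (weight _ m); apply/funext => j.
  exact: lin0 (crP j).
- rewrite cP -IHx -IHy; transitivity
    (weight (fun i => e * toral_coord x i + toral_coord y i) m).
    by congr (weight _ m); apply/funext => i; exact: crP.
  exact: weight_linear.
case: m' => [T|j|j|m1 m2].
- rewrite (toral_char_gH G d (@mono_formP m) (@mono_formS m)); congr (weight _ m).
  by apply/funext => i; exact: (toral_char_gH G d (chi_linr _) (chi_Sr _)).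
- rewrite (toral_char_gE G d (@mono_formP m) (@mono_formS m)) -[RHS](weight0 m).
  congr (weight _ m).
  by apply/funext => i; exact: (toral_char_gE G d (chi_linr _) (chi_Sr _)).
- rewrite (toral_char_gF G d (@mono_formP m) (@mono_formS m)) -[RHS](weight0 m).
  congr (weight _ m).
  by apply/funext => i; exact: (toral_char_gF G d (chi_linr _) (chi_Sr _)).
rewrite -gbr_mono (toral_char_br (@mono_formP m) (@mono_formS m)) -[RHS](weight0 m).
by congr (weight _ m); apply/funext => i; exact: toral_coord_br.
Qed.

Lemma twist_cocycle a b x y : hom gpr a x -> hom gpr b y ->
  cobr (toral_twist x y) = tact gpr toral_twist x (cobr y)
    - (-1) ^+ (a && b) *: tact gpr toral_twist y (cobr x).
Proof.
have LV := gP_lie_superalgebra G d R; have cL := cobrP g.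
have AL := toral_act_bilin; move=> xa; move: b y.
elim/gP_hom_mono_ind: a x / xa => [a b y _|a c u v IHu IHv b y yb|m].
- exact: (cocycle_at0l LV AL cL).
- exact: (cocycle_atl LV AL cL c (IHu b y yb) (IHv b y yb)).
apply: gP_hom_mono_ind => [b|b c u v uE vE|m'].
- exact: (cocycle_at0r LV AL cL).
- exact: (cocycle_atr LV AL cL c uE vE).
have cc m1 m2 : contract (toral_char (mono_form m1)) (cobr (gmono m2)) =
    - (pairing m1 m2 *: gmono m2).
  by rewrite (contract_cobr _ two0 _ (@mono_formP m1) (@mono_formS m1)) wdeg_mono.
have qL m1 := toral_charP (G := G) (d := d) (@mono_formP m1) (@mono_formS m1).
have q_odd m1 := toral_char_odd (G := G) (d := d) (@mono_formP m1) (@mono_formS m1).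
apply: (twist_cocycle_at LV AL toral_act_odd cL (cobr_flip g)
  (fun x y => tder_cobr g two0 (toral_coord x) y)
  (qL m) (q_odd m) (fun u => toral_act_mono u m)
  (qL m') (q_odd m') (fun u => toral_act_mono u m')
  (hom_mono G d m) (hom_mono G d m') (cc m m')).
- by rewrite cc pairing_skew scaleNr opprK.
- exact: cobr_mono.
Qed.

Lemma twist_superbialgebra : is_lie_superbialgebra_for gpr toral_twist cobr.
Proof.
have [_ [H1 H2 H3 _]] := mp_lie_superbialgebra g.
split; first exact: toral_twist_lie.
by split=> //; exact: twist_cocycle.
Qed.
End Cobracket.
End ToralTwist.

(** * The triangular decomposition and the deformed bracket *)

Section Triangular.
Context (k : fieldType) (n : nat) (G : diagram n) (d : 'I_n -> rat).
Context (R : realization_data k n).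
Local Notation h := (rz_h R).
Local Notation gP := (gP G d R).
Local Notation gbr := (@gbr k n G d R).
Local Notation gpr := (@gpr k n G d R).
Local Notation gH := (@gH k n G d R).
Local Notation gE := (@gE k n G d R).
Local Notation gF := (@gF k n G d R).
Local Notation gmono := (@gmono k n G d R).
Let HS := @gpr_superspace k n G d R.
Let brL := @gbr_bilin k n G d R.

Lemma gpr_br a x y : gpr a (gbr x y) =
  gbr (gpr false x) (gpr a y) + gbr (gpr true x) (gpr (~~ a) y).
Proof.
elim/quot_ind: x => x; elim/quot_ind: y => y.
by rewrite !(gbrE, gprE) fpr_fbr -qpiD.
Qed.

Lemma gbr_signed a x y z : hom gpr a x ->
  gbr x (gbr y z) = gbr (gbr x y) z + gbr (signed gpr a y) (gbr x z).
Proof.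
have [_ _ _ _ bj] := @gP_lie_superalgebra k n G d R.
move=> xa; elim/(parity_ind HS): y => [c u v IHu IHv|b y yb].
  by rewrite (signedP HS) !(brL.1 _ c u v, brL.2 _ c, brL.1 _ c) IHu IHv; module.
by rewrite (bj a b) // (signedE HS _ yb) (linZ (brL.1 _)).
Qed.

Lemma gbr_gHr x T : gbr x (gH T) = - gbr (gH T) x.
Proof.
have [_ _ _ bs _] := @gP_lie_superalgebra k n G d R.
elim/(parity_ind HS): x => [c u v IHu IHv|a x xa].
  by rewrite (brL.1 _ c u v) (brL.2 _ c) IHu IHv; module.
by rewrite (bs a false) ?andbF /= ?expr0 ?scale1r //; exact: hom_gH.
Qed.

(** One half, generated by the [Y i], against the opposite generators [X i];
    it is applied to both choices of sign. *)
Section Half.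
Context (X Y : 'I_n -> gP) (aY : 'I_n -> h -> k).
Local Notation sub Z := (subalg_gen gbr (fun x => exists i, x = Z i)).
Hypothesis homX : forall i, hom gpr (parity G i) (X i).
Hypothesis homY : forall i, hom gpr (parity G i) (Y i).
Hypothesis HY : forall T i, gbr (gH T) (Y i) = aY i T *: Y i.
Hypothesis XY : forall i j, exists T, gbr (X i) (Y j) = gH T.

Lemma sub_gpr a x : sub Y x -> sub Y (gpr a x).
Proof.
move=> xY; elim: xY a => {x} [x [i ->]||x y _ xY _ yY|c x _ xY|x y _ xY _ yY] a.
- rewrite (homE HS _ (homY i)); case: eqP => _; last exact: subalg_gen_zero.
  by apply: subalg_gen_gen; exists i.
- by rewrite (lin0 (prP HS a)); exact: subalg_gen_zero.
- by rewrite (linD (prP HS a)); exact: subalg_gen_add.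
- by rewrite (linZ (prP HS a)); exact: subalg_gen_scale.
- by rewrite gpr_br; apply: subalg_gen_add; exact: subalg_gen_br.
Qed.
Lemma sub_signed a x : sub Y x -> sub Y (signed gpr a x).
Proof.
by move=> xY; apply: subalg_gen_add; last apply: subalg_gen_scale; exact: sub_gpr.
Qed.
Lemma sub_opp x : sub Y x -> sub Y (- x).
Proof. by rewrite -scaleN1r; exact: subalg_gen_scale. Qed.

Lemma sub_adH T x : sub Y x -> sub Y (gbr (gH T) x).
Proof.
elim=> {x} [x [i ->]||x y _ xY _ yY|c x _ xY|x y xY xY' yY yY'].
- by rewrite HY; apply/subalg_gen_scale/subalg_gen_gen; exists i.
- by rewrite (lin0 (brL.2 _)); exact: subalg_gen_zero.
- by rewrite (linD (brL.2 _)); exact: subalg_gen_add.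
- by rewrite (linZ (brL.2 _)); exact: subalg_gen_scale.
- rewrite (gbr_signed _ _ (hom_gH G d T)).
  by apply: subalg_gen_add; apply: subalg_gen_br => //; exact: sub_signed.
Qed.

(** The bracket of [X i] with a generator of the other half lies in [h], and [h]
    normalizes that half; the rest follows by the Leibniz rule. *)
Lemma sub_adX i y : sub Y y ->
  exists T v, sub Y v /\ gbr (X i) y = gH T + v.
Proof.
have gHP := @gH_linear k n G d R.
elim=> {y} [x [j ->]||x y _ [T [v [vY E]]] _ [T' [v' [vY' E']]]
           |c x _ [T [v [vY E]]]|x y xY [T [v [vY E]]] yY [T' [v' [vY' E']]]].
- have [T E] := XY i j; exists T, 0; rewrite addr0; split=> //.
  exact: subalg_gen_zero.
- exists 0, 0; rewrite (lin0 (brL.2 _)) (lin0 gHP) addr0; split=> //.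
  exact: subalg_gen_zero.
- exists (T + T'), (v + v'); split; first exact: subalg_gen_add.
  by rewrite (linD (brL.2 _)) E E' (linD gHP) addrACA.
- exists (c *: T), (c *: v); split; first exact: subalg_gen_scale.
  by rewrite (linZ (brL.2 _)) E (linZ gHP) scalerDr.
exists 0, (gbr (gbr (X i) x) y + gbr (signed gpr (parity G i) x) (gbr (X i) y)).
split; last by rewrite (lin0 gHP) add0r (gbr_signed _ _ (homX i)).
have sx := sub_signed (parity G i) xY.
rewrite E E' (linD (brL.1 _)) (linD (brL.2 _)) gbr_gHr.
apply: subalg_gen_add; apply: subalg_gen_add.
- exact: sub_adH.
- exact: subalg_gen_br.
- exact/sub_opp/sub_adH.
- exact: subalg_gen_br.
Qed.
End Half.

Local Notation npos := (@npos k n G d R).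
Local Notation nneg := (@nneg k n G d R).

Lemma gEF_gH i l : exists T, gbr (gE i) (gF l) = gH T.
Proof.
rewrite gEF; case: eqP => _; first by eexists.
by exists 0; rewrite (lin0 (@gH_linear k n G d R)).
Qed.
Lemma gFE_gH i l : exists T, gbr (gF i) (gE l) = gH T.
Proof.
have [_ _ _ bs _] := @gP_lie_superalgebra k n G d R.
have [T E] := gEF_gH l i.
exists (- ((-1) ^+ (parity G i && parity G l) *: T)).
rewrite (bs _ _ _ _ (hom_gF G d R i) (hom_gE G d R l)) E.
by rewrite (linN (@gH_linear k n G d R)) (linZ (@gH_linear k n G d R)).
Qed.

(** The sum of the three parts is stable under the bracket with each generator,
    hence, by the Jacobi identity, with each monomial. *)
Lemma triangular_span x :
  exists u T v, [/\ npos u, nneg v & x = u + gH T + v].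
Proof.
pose S y := exists u T v, [/\ npos u, nneg v & y = u + gH T + v].
have gHP := @gH_linear k n G d R.
have HE T j : gbr (gH T) (gE j) = (rz_alpha R j T : k) *: gE j.
  exact: gHE.
have HF T j : gbr (gH T) (gF j) = (- rz_alpha R j T : k) *: gF j.
  by rewrite gHF -scaleNr.
have SL c y z : S y -> S z -> S (c *: y + z).
  move=> [u [T [v [uP vP ->]]]] [u' [T' [v' [uP' vP' ->]]]].
  exists (c *: u + u'), (c *: T + T'), (c *: v + v'); split.
  - exact/subalg_gen_add/uP'/subalg_gen_scale.
  - exact/subalg_gen_add/vP'/subalg_gen_scale.
  - by rewrite gHP; module.
have S0 : S 0.
  exists 0, 0, 0; split; try exact: subalg_gen_zero.
  by rewrite (lin0 gHP) !addr0.
have SN y z : S y -> S z -> S (y - z).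
  by move=> yS zS; rewrite addrC -scaleN1r; exact: SL.
have SZ c y : S y -> S (c *: y) by move=> yS; rewrite -[_ *: _]addr0; exact: SL.
have [_ _ _ _ bj] := @gP_lie_superalgebra k n G d R.
have ad m y : S y -> S (gbr (gmono m) y).
  elim: m y => [T|i|i|m IHm m' IHm'] y yS.
  - have [u [T' [v [uP vP ->]]]] := yS.
    exists (gbr (gH T) u), 0, (gbr (gH T) v); split.
    + exact: (sub_adH (hom_gE G d R) HE T uP).
    + exact: (sub_adH (hom_gF G d R) HF T vP).
    by rewrite !(linD (brL.2 _)) gHH (lin0 gHP).
  - have [u [T [v [uP vP ->]]]] := yS.
    have [T' [v' [vP' E]]] :=
      sub_adX (hom_gE G d R) (hom_gF G d R) HF gEF_gH i vP.
    exists (gbr (gE i) u - gbr (gH T) (gE i)), T', v'; split=> //.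
      apply: subalg_gen_add.
        by apply: subalg_gen_br uP; apply: subalg_gen_gen; exists i.
      rewrite -scaleN1r HE; do 2 apply: subalg_gen_scale.
      by apply: subalg_gen_gen; exists i.
    by rewrite !(linD (brL.2 _)) -[gmono _]/(gE i) E gbr_gHr; module.
  - have [u [T [v [uP vP ->]]]] := yS.
    have [T' [v' [vP' E]]] :=
      sub_adX (hom_gF G d R) (hom_gE G d R) HE gFE_gH i uP.
    exists v', T', (gbr (gF i) v - gbr (gH T) (gF i)); split=> //.
      apply: subalg_gen_add.
        by apply: subalg_gen_br vP; apply: subalg_gen_gen; exists i.
      rewrite -scaleN1r HF; do 2 apply: subalg_gen_scale.
      by apply: subalg_gen_gen; exists i.
    by rewrite !(linD (brL.2 _)) -[gmono _]/(gF i) E gbr_gHr; module.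
  have -> : gbr (gmono (MBr m m')) y = gbr (gmono m) (gbr (gmono m') y)
      - (-1) ^+ (mpar G m && mpar G m') *: gbr (gmono m') (gbr (gmono m) y).
    rewrite (bj _ _ _ _ _ (hom_mono G d m) (hom_mono G d m')) gbr_mono.
    by module.
  by apply: SN; last apply: SZ; [apply/IHm/IHm'|apply/IHm'/IHm].
rewrite -/(S x); elim/gP_mono_ind: x => // m.
elim: m => [T|i|i|m _ m' IHm'].
- exists 0, T, 0; split; try exact: subalg_gen_zero.
  by rewrite addr0 add0r.
- exists (gE i), 0, 0; split; try exact: subalg_gen_zero.
    by apply: subalg_gen_gen; exists i.
  by rewrite (lin0 gHP) !addr0.
- exists 0, 0, (gF i); split; try exact: subalg_gen_zero.
    by apply: subalg_gen_gen; exists i.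
  by rewrite (lin0 gHP) !add0r.
by rewrite -gbr_mono; exact: ad.
Qed.

Section Deformed.
Context (pi : gP -> h) (piP : is_triangular_projection pi).

(** The character vanishes on the generators of [n_+] and [n_-] and on brackets,
    so it only sees the component in [h]. *)
Lemma toral_char_projection (lam : h -> k^o) x : linear lam ->
  (forall i, lam (Tp R i + Tm R i) = 0) -> toral_char lam x = lam (pi x).
Proof.
move=> lamL lamS; have cL := toral_charP (G := G) (d := d) lamL lamS.
have toral_char_sub (X : 'I_n -> gP) y : (forall i, toral_char lam (X i) = 0) ->
    subalg_gen gbr (fun x => exists i, x = X i) y -> toral_char lam y = 0.
  move=> X0; elim=> {y} [y [i ->] //||y z _ yE _ zE|c y _ yE|y z _ _ _ _].
  - exact: lin0.
  - by rewrite (linD cL) yE zE addr0.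
  - by rewrite (linZ cL) yE scaler0.
  - exact: toral_char_br.
have [u [T [v [uP vP ->]]]] := triangular_span x; rewrite piP //.
rewrite !(linD cL) (toral_char_sub _ _ (toral_char_gE G d lamL lamS) uP).
rewrite (toral_char_sub _ _ (toral_char_gF G d lamL lamS) vP).
by rewrite (toral_char_gH G d lamL lamS) add0r addr0.
Qed.

(** Each correction term of the deformed bracket contracts a cobracket with a
    character.  The sign in the second one disappears because the projection kills
    odd elements. *)
Lemma deformed_brE (g : mplsba G d R) (chi : {biscalar h}) :
  AltS chi -> 2 != 0 :> k ->
  @deformed_br k g (toral chi pi) = @toral_twist k n G d R chi.
Proof.
move=> chiS two0; apply/funext => x; apply/funext => y.
have SL T := chi_Sl chiS two0 T; have SR T := chi_Sr chiS two0 T.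
rewrite /deformed_br; set f1 := fun x1 x2 => _; set f2 := fun y1 y2 => _.
(* chi(-, pi y) and chi(pi x, -) are forms on h that kill the S_i. *)
have E1 : f1 = fun u v => (toral_char (chi^~ (pi y) : h -> k^o) v : k) *: u.
  apply/funext => u; apply/funext => v; rewrite /f1 /toral.
  by rewrite (toral_char_projection _ (chi_linl chi _) (SL _)).
have E2 : f2 = fun u v => (toral_char (chi (pi x) : h -> k^o) v : k) *: u.
  apply/funext => u; apply/funext => v; rewrite /f2 /toral !sum_bool /=.
  have pE z : chi (pi z) (pi v) = toral_char (chi^~ (pi v) : h -> k^o) z.
    by rewrite (toral_char_projection _ (chi_linl chi _) (SL _)).
  rewrite !(pE (gpr _ _)) (toral_char_odd (chi_linl chi _) (SL _)).
  rewrite (toral_char_even (chi_linl chi _) (SL _)) -pE.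
  rewrite !mulr0 !scale0r !addr0 expr0 mul1r -scalerDr.
  have [_ _ ->] := HS.
  by rewrite (toral_char_projection _ (chi_linr chi _) (SR _)).
rewrite E1 E2 /toral_twist /twist /toral_act.
have := contract_cobr g two0 x (chi_linl chi (pi y)) (SL (pi y)).
have := contract_cobr g two0 y (chi_linr chi (pi x)) (SR (pi x)).
rewrite /contract => -> ->; rewrite !opprK addrAC; congr (_ + _ + _).
  rewrite -[LHS]opprK; congr (- _); rewrite -[LHS]scaleN1r -[LHS]addr0.
  rewrite -(wdeg0 y) -wdeg_linear; congr (wdeg _ y); apply/funext => i.
  rewrite addr0 mulN1r /toral_coord.
  by rewrite (toral_char_projection _ (chi_linr chi _) (SR _)) [RHS](chi_alt chiS).
congr (wdeg _ x); apply/funext => i; rewrite /toral_coord.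
by rewrite (toral_char_projection _ (chi_linr chi _) (SR _)).
Qed.
End Deformed.
End Triangular.

(** * Isomorphisms onto the deformation *)

(** A morphism of Lie superalgebras compatible with the cobrackets on generators is
    compatible with them everywhere, by the cocycle condition. *)
Section CobracketMap.
Context (k : fieldType) (n : nat) (G : diagram n) (d : 'I_n -> rat).
Context (R : realization_data k n) (g : mplsba G d R).
Context (W : lmodType k) (pr : bool -> W -> W) (br : W -> W -> W).
Context (cobr : W -> tens W W) (f : gP G d R -> W).
Hypothesis LW : is_lie_superbialgebra_for pr br cobr.
Hypotheses (fL : linear f) (fpr : forall a x, f (gpr a x) = pr a (f x)).
Hypothesis fbr : forall x y, f (gbr x y) = br (f x) (f y).
Hypothesis fH : forall T, cobr (f (gH G d T)) = 0.
Hypothesis fE : forall i,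
  cobr (f (gE G d R i)) = tmap f f (mp_cobr g (gE G d R i)).
Hypothesis fF : forall i,
  cobr (f (gF G d R i)) = tmap f f (mp_cobr g (gF G d R i)).

Lemma cobracket_map x : cobr (f x) = tmap f f (mp_cobr g x).
Proof.
have [[SW [bWr bWl] _ _ _] [[cL _] _ _ cC]] := LW.
have bW : bilin br by split.
have ffL := tmapP fL fL; have c1L := cobrP g.
have SV := gpr_superspace G d R; have bV := gbr_bilin G d R.
elim/gP_gen_ind: x => [|c x y IHx IHy|T|//|//|m m' IHm IHm'].
- by rewrite (lin0 fL) (lin0 cL) (lin0 c1L) (lin0 ffL).
- by rewrite fL cL c1L ffL IHx IHy.
- by rewrite fH mp_cobrH (lin0 ffL).
rewrite fbr cobr_mono (linB ffL) (linZ ffL).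
rewrite -!(tact_map SV SW fL fpr bV bW fbr) -IHm -IHm'.
exact: cC (map_hom fpr (hom_mono G d m)) (map_hom fpr (hom_mono G d m')).
Qed.
End CobracketMap.

Section TwistedHom.
Context (k : fieldType) (n : nat) (G : diagram n) (d : 'I_n -> rat).
Hypothesis two0 : 2 != 0 :> k.

(** [R'] is [R] deformed by [chi], up to the identification [phi] of the Cartan
    spaces, and [chi'] is the form on [rz_h R'] that undoes the deformation. *)
Record twisted_along (R R' : realization_data k n) (chi : {biscalar rz_h R})
    (chi' : {biscalar rz_h R'}) (phi : rz_h R' -> rz_h R) : Prop := {
  ta_linear : linear phi;
  ta_Tp : forall i, phi (Tp R' i) = Tp R i;
  ta_Tm : forall i, phi (Tm R' i) = Tm R i;
  ta_alpha : forall j T,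
    rz_alpha R' j T = rz_alpha R j (phi T) + chi (phi T) (Tp R j) :> k;
  ta_chi : forall x y, chi' x y = - chi (phi x) (phi y) }.

Section OneWay.
Context (R R' : realization_data k n) (chi : {biscalar rz_h R}).
Context (chi' : {biscalar rz_h R'}) (phi : rz_h R' -> rz_h R).
Hypotheses (TA : twisted_along chi chi' phi) (chiS : AltS chi) (chiS' : AltS chi').

(** The [E_i], the [F_i] and all brackets lie in the kernel [K] of the characters, where
    the twisted bracket is the original one; only the action of [h] changes, and
    it changes the roots by [chi(-, T_j^+)]. *)
Lemma twisted_relations : satisfies_relations G d (R := R')
  (@gpr k n G d R) (toral_twist chi) (fun T => gH G d (phi T))
  (gE G d R) (gF G d R).
Proof.
have chL i := chi_linr chi (Tp R i); have chS i T := chi_Sr chiS two0 T i.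
have tcH T i : toral_coord chi (gH G d T) i = chi (Tp R i) T.
  exact: (toral_char_gH G d (chL i) (chS^~ (Tp R i))).
have tcE i j : toral_coord chi (gE G d R j) i = 0.
  exact: (toral_char_gE G d (chL i) (chS^~ (Tp R i))).
have tcF i j : toral_coord chi (gF G d R j) i = 0.
  exact: (toral_char_gF G d (chL i) (chS^~ (Tp R i))).
have actE j x : toral_act chi (gE G d R j) x = 0 by exact: wdeg_zero.
have actF j x : toral_act chi (gF G d R j) x = 0 by exact: wdeg_zero.
have gHP := @gH_linear k n G d R; have fL := ta_linear TA.
pose K (x : gP G d R) := forall i, toral_coord chi x i = 0.
have agree x y : K x -> K y -> toral_twist chi x y = gbr x y.
  move=> x0 y0; rewrite /toral_twist /twist /toral_act.
  by rewrite !wdeg_zero // subr0 addr0.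
have Kbr x y : K (gbr x y) by move=> i; exact: toral_coord_br.
split.
- exact: linear_comp gHP fL.
- by move=> T; exact: hom_gH.
- by move=> i; exact: hom_gE.
- by move=> i; exact: hom_gF.
- move=> T T'; rewrite /toral_twist /twist gHH /toral_act !wdeg_gH.
  by rewrite subr0 addr0.
- move=> T j; rewrite /toral_twist /twist actE addr0 gHE /toral_act wdeg_gE.
  by rewrite tcH (ta_alpha TA) [chi (Tp R j) _](chi_alt chiS); module.
- move=> T j; rewrite /toral_twist /twist actF addr0 gHF /toral_act wdeg_gF.
  by rewrite tcH (ta_alpha TA) [chi (Tp R j) _](chi_alt chiS); module.
- move=> i l; rewrite agree ?gEF //.
  case: eqP => // _; rewrite -(ta_Tp TA) -(ta_Tm TA).
  by rewrite (linZ fL) (linD fL).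
- move=> x xS; apply: (@gserre_E k n G d R).
  exact: serre_agree agree Kbr (fun j i => tcE i j) xS.
- move=> x xS; apply: (@gserre_F k n G d R).
  exact: serre_agree agree Kbr (fun j i => tcF i j) xS.
Qed.

Definition twisted_hom : gP G d R' -> gP G d R :=
  eval_gP (toral_twist chi) (fun T => gH G d (phi T)) (gE G d R) (gF G d R).

Let LT := @toral_twist_lie k n G d R chi chiS two0.

Lemma twisted_homP : linear twisted_hom.
Proof. exact: eval_gPP LT twisted_relations. Qed.
Lemma twisted_hom_br x y :
  twisted_hom (gbr x y) = toral_twist chi (twisted_hom x) (twisted_hom y).
Proof. exact: (eval_gbr LT twisted_relations). Qed.
Lemma twisted_hom_pr a x : twisted_hom (gpr a x) = gpr a (twisted_hom x).
Proof. exact: (eval_gpr LT twisted_relations). Qed.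
Lemma twisted_hom_gH T : twisted_hom (gH G d T) = gH G d (phi T).
Proof. exact: (eval_gH LT twisted_relations). Qed.
Lemma twisted_hom_gE i : twisted_hom (gE G d R' i) = gE G d R i.
Proof. exact: (eval_gE LT twisted_relations). Qed.
Lemma twisted_hom_gF i : twisted_hom (gF G d R' i) = gF G d R i.
Proof. exact: (eval_gF LT twisted_relations). Qed.

Lemma wdeg_twist c (x y : gP G d R) : wdeg c (toral_twist chi x y) =
  toral_twist chi (wdeg c x) y + toral_twist chi x (wdeg c y).
Proof.
have act0 u v : toral_act chi (wdeg c u) v = 0 :> gP G d R.
  by apply: wdeg_zero => i; exact: toral_coord_wdeg.
rewrite /toral_twist /twist !act0 (linD (wdegP c)) (linB (wdegP c)) wdeg_br.
rewrite /toral_act !(wdeg_comm c (toral_coord chi _)).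
by module.
Qed.

Lemma twisted_hom_wdeg c x : twisted_hom (wdeg c x) = wdeg c (twisted_hom x).
Proof.
have fL := twisted_homP.
elim/gP_gen_ind: x => [|e x y IHx IHy|T|i|i|m m' IHm IHm'].
- by rewrite (lin0 (wdegP _)) (lin0 fL) (lin0 (wdegP _)).
- by rewrite wdegP !fL wdegP IHx IHy.
- by rewrite wdeg_gH (lin0 fL) twisted_hom_gH wdeg_gH.
- by rewrite wdeg_gE (linZ fL) twisted_hom_gE wdeg_gE.
- by rewrite wdeg_gF (linZ fL) twisted_hom_gF wdeg_gF.
by rewrite wdeg_br (linD fL) !twisted_hom_br IHm IHm' wdeg_twist.
Qed.

Lemma toral_coord_twisted_hom x i :
  toral_coord chi' x i = - toral_coord chi (twisted_hom x) i.
Proof.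
have fL := twisted_homP; rewrite /toral_coord.
have chL := chi_linr chi (Tp R i); have chS j := chi_Sr chiS two0 (Tp R i) j.
have chL' := chi_linr chi' (Tp R' i).
have chS' j := chi_Sr chiS' two0 (Tp R' i) j.
have cL := toral_charP (G := G) (d := d) chL chS.
have cL' := toral_charP (G := G) (d := d) chL' chS'.
elim/gP_gen_ind: x => [|e x y IHx IHy|T|j|j|m m' _ _].
- by rewrite (lin0 cL') (lin0 fL) (lin0 cL) oppr0.
- by rewrite cL' fL cL IHx IHy scalerN opprD.
- rewrite twisted_hom_gH (toral_char_gH G d chL chS) (toral_char_gH G d chL' chS').
  by rewrite (ta_chi TA) (ta_Tp TA).
- by rewrite twisted_hom_gE (toral_char_gE G d chL chS) (toral_char_gE G d chL' chS')
    oppr0.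
- by rewrite twisted_hom_gF (toral_char_gF G d chL chS) (toral_char_gF G d chL' chS')
    oppr0.
rewrite twisted_hom_br (toral_char_br chL' chS') /toral_twist /twist.
by rewrite (linD cL) (linB cL) (toral_char_br chL chS)
  !(toral_char_wdeg chL chS) subr0 addr0 oppr0.
Qed.

(** Twisting by [chi'], which is [- chi] through [phi], undoes the twist by
    [chi]. *)
Lemma twisted_hom_twist x y :
  twisted_hom (toral_twist chi' x y) = gbr (twisted_hom x) (twisted_hom y).
Proof.
have fL := twisted_homP.
rewrite /toral_twist /twist (linD fL) (linB fL) twisted_hom_br.
rewrite /toral_act !twisted_hom_wdeg /toral_twist /twist /toral_act.
have E z z' : wdeg (toral_coord chi' z) z' =
    - wdeg (toral_coord chi (twisted_hom z)) z' :> gP G d R.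
  rewrite -[RHS]scaleN1r -[RHS]addr0 -(wdeg0 z') -wdeg_linear.
  congr (wdeg _ z'); apply/funext => i; rewrite toral_coord_twisted_hom.
  by rewrite mulN1r addr0.
by rewrite !E; module.
Qed.

End OneWay.

Lemma twisted_homK (R R' : realization_data k n) (chi : {biscalar rz_h R})
    (chi' : {biscalar rz_h R'}) phi psi :
  twisted_along chi chi' phi -> twisted_along chi' chi psi ->
  AltS chi -> AltS chi' -> cancel psi phi ->
  cancel (twisted_hom chi' psi) (twisted_hom chi phi).
Proof.
move=> TA TA' S S' psiK.
have fL := twisted_homP TA S; have fL' := twisted_homP TA' S'.
elim/gP_gen_ind => [|e x y IHx IHy|T|i|i|m m' IHm IHm'].
- by rewrite (lin0 fL') (lin0 fL).
- by rewrite fL' fL IHx IHy.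
- by rewrite (twisted_hom_gH TA' S') (twisted_hom_gH TA S) psiK.
- by rewrite (twisted_hom_gE TA' S') (twisted_hom_gE TA S).
- by rewrite (twisted_hom_gF TA' S') (twisted_hom_gF TA S).
rewrite (twisted_hom_br TA' S') (twisted_hom_twist TA S S').
by rewrite IHm IHm'.
Qed.
End TwistedHom.

Lemma biscalar_exists (k : fieldType) (V : lmodType k) (f : V -> V -> k^o) :
  bilin f -> exists chi : {biscalar V}, forall x y, chi x y = f x y.
Proof.
case=> fl fr; pose f' : V -> V -> k := f.
have bf : bilinear_for *%R *%R f' by split.
pose m := bilinear_isBilinear.Build k V V k _ _ f' bf.
pose chi : {biscalar V} := HB.pack f' m.
by exists chi.
Qed.

Section Main.
Context (k : fieldType) (n : nat) (G : diagram n) (d : 'I_n -> rat).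
Hypothesis two0 : 2 != 0 :> k.

Section Iso.
Context (R R' : realization_data k n) (chi : {biscalar rz_h R}).
Context (chiS : AltS chi) (phi : rz_h R' -> rz_h R) (psi : rz_h R -> rz_h R').
Hypotheses (phiL : linear phi) (phiK : cancel phi psi) (psiK : cancel psi phi).
Hypotheses (phi_Tp : forall i, phi (Tp R' i) = Tp R i).
Hypotheses (phi_Tm : forall i, phi (Tm R' i) = Tm R i).
Hypothesis phi_alpha : forall j T,
  rz_alpha R' j T = rz_alpha R j (phi T) + chi (phi T) (Tp R j) :> k.
Context (g : mplsba G d R) (pi : gP G d R -> rz_h R).
Hypothesis piP : is_triangular_projection pi.

(** The cobracket on the algebra of [R'] is transported from the deformation. *)
Lemma toral_deformation_iso :
  inhabited (mplsba G d R') /\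
  forall g' : mplsba G d R', lsba_iso g' (@deform k g (toral chi pi)).
Proof.
have phi_bilin : bilin (fun x y => - chi (phi x) (phi y) : k^o).
  split=> [y|x] a u v; rewrite phiL ?linearPl ?linearPr /=;
    by rewrite opprD -mulrN.
have [chi' chi'E] := biscalar_exists phi_bilin.
have chiS' : AltS chi'.
  have phiS i : phi (Ts R' i) = Ts R i.
    by rewrite /Ts (linZ phiL) (linD phiL) phi_Tp phi_Tm.
  split=> [x y|i x]; rewrite !chi'E ?phiS.
    by rewrite (chi_alt chiS) opprK.
  by case: chiS => _ /(_ i (phi x)) [-> ->]; rewrite oppr0.
have TA : twisted_along chi chi' phi by split.
have TA' : twisted_along chi' chi psi.
  have psiL : linear psi := can_linear phiL phiK psiK.
  split=> //.
  - by move=> i; rewrite -phi_Tp phiK.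
  - by move=> i; rewrite -phi_Tm phiK.
  - by move=> j T; rewrite phi_alpha chi'E psiK phi_Tp addrK.
  - by move=> x y; rewrite chi'E !psiK opprK.
pose f := @twisted_hom k n G d R R' chi phi.
pose f' := @twisted_hom k n G d R' R chi' psi.
have fL : linear f := twisted_homP two0 TA chiS.
have fL' : linear f' := twisted_homP two0 TA' chiS'.
have fK : cancel f f' := twisted_homK two0 TA' TA chiS' chiS phiK.
have fK' : cancel f' f := twisted_homK two0 TA TA' chiS chiS' psiK.
have fpr a x : f (gpr a x) = gpr a (f x) := twisted_hom_pr two0 TA chiS a x.
have fbr x y : f (gbr x y) = toral_twist chi (f x) (f y) :=
  twisted_hom_br two0 TA chiS x y.
have fH T : f (gH G d T) = gH G d (phi T) := twisted_hom_gH G d two0 TA chiS T.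
have fE i : f (gE G d R' i) = gE G d R i := twisted_hom_gE G d two0 TA chiS i.
have fF i : f (gF G d R' i) = gF G d R i := twisted_hom_gF G d two0 TA chiS i.
have fE' i : f' (gE G d R i) = gE G d R' i := twisted_hom_gE G d two0 TA' chiS' i.
have fF' i : f' (gF G d R i) = gF G d R' i := twisted_hom_gF G d two0 TA' chiS' i.
have fHp i : f (gH G d (Tp R' i)) = gH G d (Tp R i) by rewrite fH phi_Tp.
have fHm i : f (gH G d (Tm R' i)) = gH G d (Tm R i) by rewrite fH phi_Tm.
have twS := twist_superbialgebra chiS two0 g.
have ffL' := tmapP fL' fL'.
split.
  have wedgeE T x a : hom (@gpr k n G d R') a x ->
      2 *: wedge (@gpr k n G d R') (gH G d T) x =
      tensor (gH G d T) x - tensor x (gH G d T).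
    move=> xa; rewrite /wedge scalerA divff // scale1r.
    by rewrite (sflipT (gpr_superspace G d R') (hom_gH G d T) xa) expr0 scale1r.
  constructor; refine (@Mplsba k n G d R'
    (fun x => tmap f' f' (mp_cobr g (f x))) _ _ _ _).
  - exact: transport_superbialgebra twS (gP_lie_superalgebra G d R') fL fpr fbr fK fK'.
  - by move=> T; rewrite fH mp_cobrH (lin0 ffL').
  - move=> i; rewrite (wedgeE _ _ _ (hom_gE G d R' i)) fE (cobrE g two0).
    by rewrite (linB ffL') !(tmapT fL' fL') fE' -fHp fK.
  - move=> i; rewrite (wedgeE _ _ _ (hom_gF G d R' i)) fF (cobrF g two0).
    by rewrite (linB ffL') !(tmapT fL' fL') fF' -fHm fK.
move=> g'; have defE := deformed_brE piP g chiS two0.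
have ffL := tmapP fL fL.
have fcobr : forall x, mp_cobr g (f x) = tmap f f (mp_cobr g' x).
  apply: (cobracket_map (g := g') twS fL fpr fbr) => [T|i|i].
  - by rewrite fH mp_cobrH.
  - by rewrite fE !cobrE // (linB ffL) !(tmapT fL fL) fE fHp.
  - by rewrite fF !cobrF // (linB ffL) !(tmapT fL fL) fF fHm.
split.
- exact: mp_lie_superbialgebra.
- have dS : is_lie_superbialgebra_for (@gpr k n G d R)
      (@deformed_br k g (toral chi pi)) (mp_cobr g) by rewrite defE.
  exact: dS.
pose F : {linear g' -> @deform k g (toral chi pi)} :=
  HB.pack f (GRing.isLinear.Build k _ _ _ f fL).
exists F; split.
- by exists f'.
- exact: fpr.
- have fdef x y : f (gbr x y) = @deformed_br k g (toral chi pi) (f x) (f y).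
    by rewrite defE fbr.
  exact: fdef.
- exact: fcobr.
Qed.
End Iso.

(** * Split and minimal realizations *)

Lemma linear_span_ext (V : vectType k) (W : lmodType k) (X : seq V) (f g : V -> W) :
  linear f -> linear g -> vector.span X = fullv ->
  (forall x, x \in X -> f x = g x) -> f =1 g.
Proof.
move=> fL gL Xf fg x.
have fS (I : seq 'I_(size X)) (F : 'I_(size X) -> V) (e : V -> W) : linear e ->
    e (\sum_(i <- I) F i) = \sum_(i <- I) e (F i).
  move=> eL; exact: (big_morph e (linD eL) (lin0 eL)).
have /(coord_span (X := in_tuple X)) -> : x \in vector.span (in_tuple X).
  by rewrite /= Xf memvf.
rewrite !fS //; apply: eq_bigr => i _.
by rewrite (linZ fL) (linZ gL) fg // mem_nth.
Qed.

Lemma split_linear_map (R : realization_data k n) (W : lmodType k)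
    (wp wm : 'I_n -> W) : split_rz R ->
  exists f : rz_h R -> W, [/\ linear f,
    forall i, f (Tp R i) = wp i & forall i, f (Tm R i) = wm i].
Proof.
move=> Rs; have [f fE] := @linear_of_free k _ W (coroots R)
  ([seq wp i | i : 'I_n] ++ [seq wm i | i : 'I_n]).
move: fE; rewrite /coroots map_cat -(map_comp f (Tp R)) -(map_comp f (Tm R)).
rewrite !size_cat !size_map => /(_ Rs erefl) /eqP.
rewrite eqseq_cat ?size_map // => /andP[/eqP fp /eqP fm].
exists f; split=> [|i|i].
- exact: linearP.
- by move/eq_in_map: fp => /(_ i) /= -> //; rewrite mem_enum.
- by move/eq_in_map: fm => /(_ i) /= -> //; rewrite mem_enum.
Qed.

(** Take [c] sending [T_i^+] to the [i]-th basis vector and [T_i^-] to its opposite,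
    hence [S_i] to zero, and [chi x y = c x M (c y)^T]. *)
Lemma split_AltS (R : realization_data k n) (M : 'M[k]_n) : split_rz R ->
  M^T = - M -> exists2 chi : {biscalar rz_h R}, AltS chi &
  forall i j, chi (Tp R i) (Tp R j) = M i j.
Proof.
move=> Rs MT.
have [c [cL cp cm]] := split_linear_map (fun i => 'e_i) (fun i => - 'e_i : 'rV[k]_n) Rs.
have cb : bilin (fun x y => (c x *m M *m (c y)^T) 0 0 : k^o).
  split=> [y|x] a u v; rewrite cL.
    by rewrite !mulmxDl -!scalemxAl !mxE.
  by rewrite linearP /= mulmxDr -scalemxAr !mxE.
have [chi chiE] := biscalar_exists cb.
have cS i : c (Ts R i) = 0.
  by rewrite /Ts (linZ cL) (linD cL) cp cm subrr scaler0.
exists chi.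
  split=> [x y|i x]; rewrite !chiE; last first.
    by rewrite cS linear0 mulmx0 !mul0mx mxE.
  rewrite -[LHS]/((c x *m M *m (c y)^T) 0 0) -[RHS]mulN1r.
  have -> : c x *m M *m (c y)^T = - (c y *m M *m (c x)^T)^T.
    by rewrite !trmx_mul trmxK MT mulNmx mulmxN opprK mulmxA.
  by rewrite !mxE mulN1r.
by move=> i j; rewrite chiE !cp -rowE trmx_delta -colE !mxE.
Qed.

Lemma deform_alpha (R : realization_data k n) (chi : {biscalar rz_h R}) j T :
  rz_alpha (deform_rz chi) j T = rz_alpha R j T + chi T (Tp R j) :> k.
Proof.
pose cl : {linear rz_h R -> k^o} := HB.pack (chi^~ (Tp R j) : rz_h R -> k^o)
  (GRing.isLinear.Build k (rz_h R) k^o _ _ (chi_linl chi (Tp R j))).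
by rewrite /deform_rz /= add_lfunE (lfunE cl).
Qed.

Lemma deform_iso (R : realization_data k n) (chi : {biscalar rz_h R})
    (g : mplsba G d R) (pi : gP G d R -> rz_h R) :
  AltS chi -> is_triangular_projection pi ->
  inhabited (mplsba G d (deform_rz chi)) /\
  forall g' : mplsba G d (deform_rz chi), lsba_iso g' (@deform k g (toral chi pi)).
Proof.
move=> chiS piP.
apply: (@toral_deformation_iso R (deform_rz chi) chi chiS id id) => // j T.
exact: deform_alpha.
Qed.

Lemma deform_realization (P P' : 'M[k]_n) (R : realization_data k n)
    (chi : {biscalar rz_h R}) : is_realization P R -> AltS chi ->
  P' = deform_mx P chi -> is_realization P' (deform_rz chi).
Proof.
move=> [Rp Rm Rf] chiS ->; split=> // i j.
  by rewrite deform_alpha Rp !mxE.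
rewrite deform_alpha Rm !mxE; congr (_ + _).
have : chi (Tp R i + Tm R i) (Tp R j) = 0 by exact: chi_Sl.
rewrite linearDl => /eqP; rewrite addr_eq0 => /eqP.
by rewrite (chi_alt chiS (Tp R j)) => ->; rewrite opprK.
Qed.

Lemma cartan_type_difference (P P' : 'M[k]_n) :
  cartan_type G d P -> cartan_type G d P' -> (P' - P)^T = - (P' - P).
Proof.
have half_inj (V : lmodType k) (u v : V) : 2^-1 *: u = 2^-1 *: v -> u = v.
  by apply: scalerI; rewrite invr_eq0.
rewrite /cartan_type => <- /half_inj E; rewrite linearB /=; apply/eqP.
by rewrite opprB subr_eq addrAC -E addrAC subrr add0r.
Qed.

Lemma split_deformation (P P' : 'M[k]_n) (R : realization_data k n) :
  cartan_type G d P -> cartan_type G d P' -> split_rz R ->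
  exists2 chi : {biscalar rz_h R}, AltS chi & P' = deform_mx P chi.
Proof.
move=> cP cP' Rs; have [chi chiS chiE] := split_AltS Rs (cartan_type_difference cP cP').
by exists chi => //; apply/matrixP => i j; rewrite !mxE chiE !mxE addrCA subrr addr0.
Qed.

(** Matching coroots identifies the Cartan spaces, and the roots correspond since
    they have the same values on coroots, which span. *)
Lemma split_minimal_iso (P P' : 'M[k]_n) (R R' : realization_data k n) :
  cartan_type G d P -> cartan_type G d P' ->
  is_realization P R -> split_rz R -> minimal_rz R ->
  is_realization P' R' -> split_rz R' -> minimal_rz R' ->
  forall (g : mplsba G d R) (pi : gP G d R -> rz_h R),
  is_triangular_projection pi -> forall g' : mplsba G d R',
  exists2 chi : {biscalar (rz_h R)}, AltS chi &
    lsba_iso g' (@deform k g (toral chi pi)).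
Proof.
move=> cP cP' PR Rs Rm PR' Rs' Rm' g pi piP g'.
have [chi chiS EP'] := split_deformation cP cP' Rs; exists chi => //.
have [Dp Dm _] := deform_realization PR chiS EP'; have [Rp' Rm'' _] := PR'.
have [phi [phiL phip phim]] := split_linear_map (Tp R) (Tm R) Rs'.
have [psi [psiL psip psim]] := split_linear_map (Tp R') (Tm R') Rs.
have coP (S : realization_data k n) x : x \in coroots S ->
    exists i, x = Tp S i \/ x = Tm S i.
  by rewrite mem_cat => /orP[] /mapP[i _ ->]; exists i; [left|right].
have phiK : cancel phi psi.
  apply: linear_span_ext (linear_comp psiL phiL) _ Rm' _ => // x /coP[i [] ->].
    by rewrite phip psip.
  by rewrite phim psim.
have psiK : cancel psi phi.
  apply: linear_span_ext (linear_comp phiL psiL) _ Rm _ => // x /coP[i [] ->].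
    by rewrite psip phip.
  by rewrite psim phim.
have phi_alpha j T :
    rz_alpha R' j T = rz_alpha R j (phi T) + chi (phi T) (Tp R j) :> k.
  rewrite -deform_alpha; move: T.
  apply: (linear_span_ext (W := k^o)) Rm' _ => [||x /coP[i [] ->]].
  - exact: linearP.
  - by apply: linear_comp phiL; exact: linearP.
  - by rewrite phip Rp' -Dp.
  - by rewrite phim Rm'' -Dm.
have [_] := toral_deformation_iso chiS phiL phiK psiK phip phim phi_alpha g piP.
exact.
Qed.

Lemma sym_cartan_type : is_symmetrizer G d -> cartan_type G d (sym_cartan k G d).
Proof.
move=> [_ sym _]; rewrite /cartan_type.
have -> : (sym_cartan k G d)^T = sym_cartan k G d.
  by apply/matrixP => i j; rewrite mxE [LHS]mxE [RHS]mxE sym.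
by rewrite -[X in X + X]scale1r -scalerDl scalerA mulVf ?scale1r.
Qed.
End Main.

Theorem theorem3p4p3 (k : fieldType) (k_char0 : [pchar k] =i pred0)
    (n : nat) (D : diagram n) (D_ok : is_diagram D)
    (d : 'I_n -> rat) (d_ok : is_minimal_symmetrizer D d) :
  (* (a) *)
  (forall (P : 'M[k]_n) (R : realization_data k n),
    cartan_type D d P -> is_realization P R ->
    forall (g : mplsba D d R) (pi : gP D d R -> rz_h R),
    is_triangular_projection pi ->
    forall chi : {biscalar (rz_h R)}, AltS chi ->
    inhabited (mplsba D d (deform_rz chi)) /\
    forall g' : mplsba D d (deform_rz chi),
      lsba_iso g' (@deform k g (toral chi pi))) /\
  (* (b.1) *)
  (forall (P P' : 'M[k]_n) (R : realization_data k n),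
    cartan_type D d P -> cartan_type D d P' ->
    is_realization P R -> split_rz R ->
    forall (g : mplsba D d R) (pi : gP D d R -> rz_h R),
    is_triangular_projection pi ->
    exists chi : {biscalar (rz_h R)},
      [/\ AltS chi,
          P' = deform_mx P chi,
          is_realization P' (deform_rz chi) /\ split_rz (deform_rz chi),
          inhabited (mplsba D d (deform_rz chi))
        & forall g' : mplsba D d (deform_rz chi),
            lsba_iso g' (@deform k g (toral chi pi))]) /\
  (* (b.2) *)
  (forall (P P' : 'M[k]_n) (R R' : realization_data k n),
    cartan_type D d P -> cartan_type D d P' ->
    is_realization P R -> split_rz R -> minimal_rz R ->
    is_realization P' R' -> split_rz R' -> minimal_rz R' ->
    forall (g : mplsba D d R) (pi : gP D d R -> rz_h R),
    is_triangular_projection pi ->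
    forall g' : mplsba D d R',
    exists2 chi : {biscalar (rz_h R)}, AltS chi &
      lsba_iso g' (@deform k g (toral chi pi))) /\
  (* (b.3): gY is the Lie superbialgebra of Yamane *)
  (forall RY : realization_data k n,
    is_realization (sym_cartan k D d) RY ->
    split_rz RY -> straight RY -> minimal_rz RY ->
    forall (gY : mplsba D d RY) (piY : gP D d RY -> rz_h RY),
    is_triangular_projection piY ->
    forall (P : 'M[k]_n) (R : realization_data k n),
    cartan_type D d P ->
    is_realization P R -> split_rz R -> minimal_rz R ->
    forall g : mplsba D d R,
    exists2 chi : {biscalar (rz_h RY)}, AltS chi &
      lsba_iso g (@deform k gY (toral chi piY))).
Proof.
have two0 : 2 != 0 :> k.
  by have := k_char0 2; rewrite !inE /= => /negbT.
split; [|split; [|split]].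
- by move=> P R _ _ g pi piP chi chiS; exact: deform_iso.
- move=> P P' R cP cP' PR Rs g pi piP.
  have [chi chiS EP'] := split_deformation two0 cP cP' Rs.
  have [inh iso] := deform_iso two0 g chiS piP.
  exists chi; split=> //; split=> //.
  exact: deform_realization PR chiS EP'.
- move=> P P' R R' cP cP' PR Rs Rm PR' Rs' Rm' g pi piP g'.
  exact: (split_minimal_iso two0 cP cP' PR Rs Rm PR' Rs' Rm').
- move=> RY RYP RYs _ RYm gY piY piYP P R cP PR Rs Rm g.
  have [dS _ _] := d_ok.
  exact: (split_minimal_iso two0 (sym_cartan_type two0 dS) cP RYP RYs RYm PR Rs Rm).
Qed.
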